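(* Let $q$ be a positive integer and $\omega=e^{i\pi/q}$. Then $$\frac1q\sum_{k=0}^{q-1}\gamma(\omega^{2k+1})=\int_0^1\int_0^1\frac{1-x}{(1+x^qy^q)(-\log xy)}\,dx\,dy=\frac{1}{2q}\left[\psi\!\left(\frac{q+1}{2q}\right)-\psi\!\left(\frac{1}{2q}\right)\right]-\log\frac{\Gamma\left(\frac{1}{2q}\right)\Gamma\left(\frac{q+2}{2q}\right)}{\Gamma\left(\frac1q\right)\Gamma\left(\frac{q+1}{2q}\right)}.$$
   Context: $\gamma(z)=\sum_{n=1}^{\infty} z^{n-1}\left(\frac{1}{n}-\log\frac{n+1}{n}\right)$ for $|z|\le1$. $\Gamma$ is Euler's gamma function and $\psi=\Gamma'/\Gamma$ is the digamma function. *)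

(* Defs.v *)
From Stdlib Require Import Reals.
From Coquelicot Require Import Coquelicot.
Open Scope R_scope.

(* coefficient of z^m (m = n-1) in gamma(z):  1/n - log((n+1)/n), n = m+1 *)
Definition gamma_coef (m : nat) : R :=
  / (INR m + 1) - ln ((INR m + 2) / (INR m + 1)).

Definition gamma_series (z : C) : C :=
  (Series (fun m => Re (Cpow z m) * gamma_coef m),
   Series (fun m => Im (Cpow z m) * gamma_coef m)).

Definition Gamma (x : R) : R :=
  RInt_gen (fun t => Rpower t (x - 1) * exp (- t))
           (at_right 0) (Rbar_locally p_infty).

Definition digamma (x : R) : R := Derive Gamma x / Gamma x.

Definition omega (q : nat) : C := (cos (PI / INR q), sin (PI / INR q)).

Definition integrand34 (q : nat) (x y : R) : R :=
  (1 - x) / ((1 + x ^ q * y ^ q) * (- ln (x * y))).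

(* Main.v *)
(** Averaging over the odd powers of omega kills every coefficient of gamma(z) whose index is not a
    multiple of q, so the left-hand side is S = sum_j (-1)^j gamma_coef (q j).

    Gamma side: ln Gamma is convex with ln Gamma (x + 1) = ln x + ln Gamma x, which squeezes its
    increments and yields Gauss's formula
      lnGamma (y + h) - lnGamma y = lim (h ln (n + 1) - sum_(k < n) (ln (y + h + k) - ln (y + k)))
    and, dividing by h uniformly in n, psi x = lim (ln (n + 1) - sum_(k < n) 1 / (x + k)).
    Pairing consecutive terms of S expresses it through both limits at a = 1/(2q) and b = a + 1/2.

    Integral side: expanding 1 / (1 + (x y)^q) as a geometric series leaves, uniformly in y,
    the integrals of (1 - x) (x y)^m / (- ln (x y)).  With A(y) the integral of 1 / (- ln u) over
    [0, y], the substitution u = v^(m+1) gives the inner integral A(y^(m+1)) / y - A(y^(m+2)) / y^2,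
    which has the primitive A(y^(m+1)) ln y + A(y^(m+2)) / y - A(y^(m+1)) + y^(m+1) / (m + 1);
    A(y^(m+1)) - A(y^(m+2)) tends to ln ((m + 2) / (m + 1)) as y tends to 1. *)

Require Import Defs.
From Stdlib Require Import Reals Lra Lia Psatz.
From Coquelicot Require Import Coquelicot.
Open Scope R_scope.

(** * The Gamma integral and its logarithmic convexity *)

Lemma ball_R (x e y : R) : ball x e y -> x - e < y < x + e.
Proof. intros H; apply Rabs_def2 in H; unfold minus, plus, opp in H; simpl in H; lra. Qed.

Lemma is_RInt_RInt (f : R -> R) (a b : R) : ex_RInt f a b -> is_RInt f a b (RInt f a b).
Proof. exact (RInt_correct f a b). Qed.

Lemma ex_RInt_on_pos (f : R -> R) (a b : R) :
  (forall t, 0 < t -> continuous f t) -> 0 < a -> 0 < b -> ex_RInt f a b.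
Proof.
intros cf a0 b0; apply (@ex_RInt_continuous R_CompleteNormedModule).
intros t [Ht _]; apply cf.
apply Rlt_le_trans with (2 := Ht), Rmin_glb_lt; assumption.
Qed.

Lemma RInt_mono_bounds (f : R -> R) (a b c d : R) :
  (forall t, 0 < t -> continuous f t) -> (forall t, 0 < t -> 0 <= f t) ->
  0 < a -> a <= c -> c <= d -> d <= b -> RInt f c d <= RInt f a b.
Proof.
intros cf f0 a0 ac cd db.
assert (P : forall u v, 0 < u -> u <= v -> 0 <= RInt f u v).
{ intros u v u0 uv; apply RInt_ge_0; try lra.
  - apply ex_RInt_on_pos; auto; lra.
  - intros; apply f0; lra. }
assert (E1 : RInt f a c + RInt f c b = RInt f a b).
{ apply (RInt_Chasles f); apply ex_RInt_on_pos; auto; lra. }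
assert (E2 : RInt f c d + RInt f d b = RInt f c b).
{ apply (RInt_Chasles f); apply ex_RInt_on_pos; auto; lra. }
assert (A := P a c); assert (B := P d b); lra.
Qed.

(** Widening the interval can only raise the integral, so once some [[a, b]] comes within [eps] of
    the supremum, every larger interval does too. The supremum is kept in the conclusion because
    upper bounds on [Gamma] then follow from bounds on compact intervals. *)
Lemma is_RInt_gen_lub (f : R -> R) (M : R) :
  (forall t, 0 < t -> continuous f t) -> (forall t, 0 < t -> 0 <= f t) ->
  (forall a b, 0 < a -> a <= b -> RInt f a b <= M) ->
  exists l, is_RInt_gen f (at_right 0) (Rbar_locally p_infty) l /\
    is_lub (fun r => exists a b, 0 < a <= b /\ r = RInt f a b) l.
Proof.
intros cf f0 fM.
set (E := fun r => exists a b, 0 < a <= b /\ r = RInt f a b).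
destruct (completeness E) as [l Hl].
- exists M; intros r (a & b & ab & ->); apply fM; tauto.
- exists (RInt f 1 1), 1, 1; split; [lra | reflexivity].
exists l; split; [| exact Hl].
intros P [eps HP].
assert (W : exists a b, 0 < a <= b /\ l - eps < RInt f a b).
{ apply Classical_Prop.NNPP; intros N.
  assert (l <= l - eps).
  { apply (proj2 Hl); intros r (a & b & ab & ->).
    apply Rnot_lt_le; intros L; apply N; exists a, b; auto. }
  destruct eps as [e e0]; simpl in *; lra. }
destruct W as (a & b & ab & L).
apply (Filter_prod _ _ _ (fun u => 0 < u < a) (fun v => b < v)).
- exists (mkposreal a (proj1 ab)); intros u Hu u0.
  apply ball_R in Hu; simpl in Hu; lra.
- exists b; auto.
- intros u v Hu Hv; simpl.
  exists (RInt f u v); split.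
  + apply is_RInt_RInt, ex_RInt_on_pos; auto; lra.
  + apply HP.
    assert (RInt f a b <= RInt f u v) by (apply RInt_mono_bounds; auto; lra).
    assert (RInt f u v <= l).
    { apply (proj1 Hl); exists u, v; split; [lra | reflexivity]. }
    unfold ball; simpl; unfold AbsRing_ball, abs, minus, plus, opp; simpl.
    apply Rabs_def1; lra.
Qed.

Definition Gamma_kernel (x t : R) : R := Rpower t (x - 1) * exp (- t).

Lemma Gamma_kernel_gt0 (x t : R) : 0 < Gamma_kernel x t.
Proof. apply Rmult_lt_0_compat; apply exp_pos. Qed.

Lemma continuous_Gamma_kernel (x t : R) : 0 < t -> continuous (Gamma_kernel x) t.
Proof.
intros t0; apply (ex_derive_continuous (Gamma_kernel x) t).
unfold Gamma_kernel, Rpower; auto_derive; auto.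
Qed.

Lemma exp_le_exp (x y : R) : x <= y -> exp x <= exp y.
Proof.
intros [L | ->]; [apply Rlt_le, exp_increasing, L | apply Rle_refl].
Qed.

(** The inequality [1 + z <= exp z] at [z = ln (t / (2 * c + 1))] bounds [ln t] by [t / (2 * c + 1)]
    plus a constant. The divisor keeps the linear part of [c * ln t] below [t / 2] and stays nonzero
    at [c = 0]. *)
Lemma Rpower_exp_bound (c : R) : 0 <= c ->
  exists K, 0 < K /\ forall t, 0 < t -> Rpower t c * exp (- t) <= K * exp (- t / 2).
Proof.
intros c0; exists (exp (c * ln (2 * c + 1))); split; [apply exp_pos |].
intros t t0; unfold Rpower; rewrite <- !exp_plus; apply exp_le_exp.
assert (L : ln t <= t / (2 * c + 1) + ln (2 * c + 1)).
{ assert (0 < t / (2 * c + 1)) by (apply Rdiv_lt_0_compat; lra).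
  assert (E : t = t / (2 * c + 1) * (2 * c + 1)) by (field; lra).
  rewrite E at 1; rewrite ln_mult by lra.
  assert (I := exp_ineq1_le (ln (t / (2 * c + 1)))); rewrite exp_ln in I by lra; lra. }
assert (c * (t / (2 * c + 1)) <= t / 2).
{ replace (t / 2) with ((c + 1 / 2) * (t / (2 * c + 1))) by (field; lra).
  apply Rmult_le_compat_r; [apply Rlt_le, Rdiv_lt_0_compat |]; lra. }
assert (c * ln t <= c * (t / (2 * c + 1) + ln (2 * c + 1))) by (apply Rmult_le_compat_l; lra).
lra.
Qed.

Lemma RInt_Gamma_kernel_parts (x a b : R) : 0 < a -> 0 < b ->
  x * RInt (Gamma_kernel x) a b - RInt (Gamma_kernel (x + 1)) a b
  = Rpower b x * exp (- b) - Rpower a x * exp (- a).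
Proof.
intros a0 b0.
assert (I : is_RInt (fun t => x * Gamma_kernel x t - Gamma_kernel (x + 1) t) a b
              (Rpower b x * exp (- b) - Rpower a x * exp (- a))).
{ apply (is_RInt_derive (fun t => Rpower t x * exp (- t))); intros t [Ht _].
  - assert (t0 : 0 < t) by (apply Rlt_le_trans with (2 := Ht), Rmin_glb_lt; assumption).
    unfold Gamma_kernel, Rpower; auto_derive; auto.
    replace ((x - 1) * ln t) with (x * ln t + - ln t) by ring.
    replace ((x + 1 - 1) * ln t) with (x * ln t) by ring.
    rewrite exp_plus, (exp_Ropp (ln t)), exp_ln by auto; field; lra.
  - assert (t0 : 0 < t) by (apply Rlt_le_trans with (2 := Ht), Rmin_glb_lt; assumption).
    apply (continuous_minus (fun t => x * Gamma_kernel x t) (Gamma_kernel (x + 1)) t).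
    + apply (continuous_mult (fun _ => x)); [apply continuous_const | now apply continuous_Gamma_kernel].
    + now apply continuous_Gamma_kernel. }
rewrite <- (is_RInt_unique _ _ _ _ I).
assert (E : forall y, ex_RInt (Gamma_kernel y) a b).
{ intros y; apply ex_RInt_on_pos; auto; intros; now apply continuous_Gamma_kernel. }
symmetry; apply (is_RInt_unique (V := R_CompleteNormedModule)).
apply (is_RInt_minus (V := R_NormedModule)).
- apply (is_RInt_scal (V := R_NormedModule)), is_RInt_RInt, E.
- apply is_RInt_RInt, E.
Qed.

(** For [x < 1] the kernel is singular at [0]. Integration by parts trades it for the kernel of
    [x + 1], which an exponential dominates, and the boundary term at [a] has the favourable
    sign. *)
Lemma RInt_Gamma_kernel_bounded (x : R) : 0 < x ->
  exists M, forall a b, 0 < a -> a <= b -> RInt (Gamma_kernel x) a b <= M.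
Proof.
intros x0; destruct (Rpower_exp_bound x) as (K & K0 & HK); [lra |].
(* [2 * K] bounds the integral of [K * exp (- t / 2)], and the boundary term at [b] adds one more
   [K]. *)
exists (/ x * (3 * K)); intros a b a0 ab.
assert (P := RInt_Gamma_kernel_parts x a b a0 ltac:(lra)).
assert (RInt (Gamma_kernel (x + 1)) a b <= 2 * K).
{ assert (I : is_RInt (fun t => K * exp (- t / 2)) a b
               (- 2 * K * exp (- b / 2) - - 2 * K * exp (- a / 2))).
  { apply (is_RInt_derive (fun t => - 2 * K * exp (- t / 2))); intros t _.
    - auto_derive; auto; unfold Rdiv; lra.
    - apply (ex_derive_continuous (fun t => K * exp (- t / 2)) t); auto_derive; auto. }
  apply Rle_trans with (RInt (fun t => K * exp (- t / 2)) a b).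
  - apply RInt_le; auto.
    + apply ex_RInt_on_pos; try lra; intros; now apply continuous_Gamma_kernel.
    + eexists; exact I.
    + intros t Ht; unfold Gamma_kernel; replace (x + 1 - 1) with x by ring; apply HK; lra.
  - rewrite (is_RInt_unique _ _ _ _ I).
    assert (exp (- a / 2) <= 1) by (rewrite <- exp_0; apply exp_le_exp; lra).
    assert (0 < exp (- b / 2)) by apply exp_pos; nra. }
assert (Rpower b x * exp (- b) <= K).
{ apply Rle_trans with (1 := HK b ltac:(lra)).
  assert (exp (- b / 2) <= 1) by (rewrite <- exp_0; apply exp_le_exp; lra); nra. }
assert (0 < Rpower a x * exp (- a)) by (apply Rmult_lt_0_compat; apply exp_pos).
apply Rmult_le_reg_l with x; auto.
rewrite <- Rmult_assoc, Rinv_r, Rmult_1_l by lra; lra.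
Qed.

Lemma Gamma_lub (x : R) : 0 < x ->
  is_RInt_gen (Gamma_kernel x) (at_right 0) (Rbar_locally p_infty) (Gamma x) /\
  is_lub (fun r => exists a b, 0 < a <= b /\ r = RInt (Gamma_kernel x) a b) (Gamma x).
Proof.
intros x0; destruct (RInt_Gamma_kernel_bounded x x0) as [M HM].
destruct (is_RInt_gen_lub (Gamma_kernel x) M) as (l & Hl & L); auto.
- intros; now apply continuous_Gamma_kernel.
- intros; apply Rlt_le, Gamma_kernel_gt0.
- assert (E : Gamma x = l).
  { change (RInt_gen (Gamma_kernel x) (at_right 0) (Rbar_locally p_infty) = l).
    exact (is_RInt_gen_unique (Gamma_kernel x) l Hl). }
  rewrite E; auto.
Qed.

Lemma Gamma_gt0 (x : R) : 0 < x -> 0 < Gamma x.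
Proof.
intros x0; apply Rlt_le_trans with (RInt (Gamma_kernel x) 1 2).
- apply RInt_gt_0; [lra | intros; apply Gamma_kernel_gt0 |].
  intros; apply continuous_Gamma_kernel; lra.
- apply (proj1 (proj2 (Gamma_lub x x0))); exists 1, 2; split; [lra | reflexivity].
Qed.

(** In the formula of integration by parts both boundary terms vanish in the limit, so the combined
    integrand has improper integral [0] as well as [x * Gamma x - Gamma (x + 1)]. *)
Lemma Gamma_succ (x : R) : 0 < x -> Gamma (x + 1) = x * Gamma x.
Proof.
intros x0; destruct (Gamma_lub x x0) as [G _]; destruct (Gamma_lub (x + 1)) as [G1 _]; [lra |].
assert (E : is_RInt_gen (fun t => x * Gamma_kernel x t - Gamma_kernel (x + 1) t)
              (at_right 0) (Rbar_locally p_infty) (x * Gamma x - Gamma (x + 1))).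
{ apply (is_RInt_gen_minus (V := R_NormedModule)); [| exact G1].
  apply (is_RInt_gen_scal (V := R_NormedModule)); exact G. }
assert (Z : is_RInt_gen (fun t => x * Gamma_kernel x t - Gamma_kernel (x + 1) t)
              (at_right 0) (Rbar_locally p_infty) 0).
{ intros P [eps HP].
  destruct (Rpower_exp_bound x) as (K & K0 & HK); [lra |].
  assert (e0 := cond_pos eps).
  (* Below the first threshold [a ^ x < eps / 2]; beyond the second
     [K * exp (- b / 2) < eps / 2]. *)
  apply (Filter_prod _ _ _ (fun a => 0 < a < exp (ln (eps / 2) / x))
           (fun b => Rmax 1 (- 2 * ln (eps / (2 * K))) < b)).
  - exists (mkposreal _ (exp_pos (ln (eps / 2) / x))); intros u Hu u0.
    apply ball_R in Hu; simpl in Hu; lra.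
  - exists (Rmax 1 (- 2 * ln (eps / (2 * K)))); auto.
  - intros a b [a0 Ha] Hb; simpl.
    assert (b1 := Rle_lt_trans _ _ _ (Rmax_l _ _) Hb).
    assert (b2 := Rle_lt_trans _ _ _ (Rmax_r _ _) Hb).
    assert (I : forall y, is_RInt (Gamma_kernel y) a b (RInt (Gamma_kernel y) a b)).
    { intros y; apply is_RInt_RInt, ex_RInt_on_pos; try lra.
      intros; now apply continuous_Gamma_kernel. }
    exists (x * RInt (Gamma_kernel x) a b - RInt (Gamma_kernel (x + 1)) a b); split.
    { apply (is_RInt_minus (V := R_NormedModule)); [| apply I].
      apply (is_RInt_scal (V := R_NormedModule)), I. }
    apply HP; rewrite RInt_Gamma_kernel_parts by lra.
    assert (U : Rpower a x * exp (- a) < eps / 2).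
    { apply Rle_lt_trans with (Rpower a x * 1).
      - apply Rmult_le_compat_l; [apply Rlt_le, exp_pos |].
        rewrite <- exp_0; apply exp_le_exp; lra.
      - rewrite Rmult_1_r, <- (exp_ln (eps / 2)) by lra; apply exp_increasing.
        replace (ln (eps / 2)) with (x * (ln (eps / 2) / x)) by (field; lra).
        apply Rmult_lt_compat_l; auto.
        rewrite <- (ln_exp (ln (eps / 2) / x)); apply ln_increasing; auto. }
    assert (V : Rpower b x * exp (- b) < eps / 2).
    { apply Rle_lt_trans with (1 := HK b ltac:(lra)).
      assert (W : exp (- b / 2) < eps / (2 * K)).
      { rewrite <- (exp_ln (eps / (2 * K))) by (apply Rdiv_lt_0_compat; lra).
        apply exp_increasing; lra. }
      replace (eps / 2) with (K * (eps / (2 * K))) by (field; lra).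
      apply Rmult_lt_compat_l; auto. }
    assert (0 < Rpower a x * exp (- a)) by (apply Rmult_lt_0_compat; apply exp_pos).
    assert (0 < Rpower b x * exp (- b)) by (apply Rmult_lt_0_compat; apply exp_pos).
    unfold ball; simpl; unfold AbsRing_ball, abs, minus, plus, opp; simpl.
    apply Rabs_def1; lra. }
apply (is_RInt_gen_unique (V := R_CompleteNormedModule)) in E, Z.
assert (x * Gamma x - Gamma (x + 1) = 0) by (rewrite <- E; exact Z).
lra.
Qed.

(** The tangent to [exp] at the mean [w] lies below the graph; in the weighted sum of its values at
    [u] and [v] the linear terms cancel. *)
Lemma exp_convex (s t u v : R) : 0 <= s -> 0 <= t -> s + t = 1 ->
  exp (s * u + t * v) <= s * exp u + t * exp v.
Proof.
intros s0 t0 st; set (w := s * u + t * v).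
assert (T : forall z, exp w * (1 + (z - w)) <= exp z).
{ intros z; replace (exp z) with (exp w * exp (z - w)) by (rewrite <- exp_plus; f_equal; ring).
  apply Rmult_le_compat_l; [apply Rlt_le, exp_pos | apply exp_ineq1_le]. }
assert (A := Rmult_le_compat_l _ _ _ s0 (T u)).
assert (B := Rmult_le_compat_l _ _ _ t0 (T v)).
apply Rle_trans with (2 := Rplus_le_compat _ _ _ _ A B).
right; unfold w; replace t with (1 - s) by lra; ring.
Qed.

Definition lnGamma (x : R) : R := ln (Gamma x).

(* Hoelder's inequality, obtained by integrating Young's inequality for the normalised kernels. *)
Lemma lnGamma_convex (s t x y : R) : 0 < s -> 0 < t -> s + t = 1 -> 0 < x -> 0 < y ->
  lnGamma (s * x + t * y) <= s * lnGamma x + t * lnGamma y.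
Proof.
intros s0 t0 st x0 y0.
assert (z0 : 0 < s * x + t * y) by (apply Rplus_lt_0_compat; apply Rmult_lt_0_compat; auto).
set (z := s * x + t * y) in *.
set (c := s * lnGamma x + t * lnGamma y).
rewrite <- (ln_exp c); apply ln_le; [now apply Gamma_gt0 |].
apply (proj2 (proj2 (Gamma_lub z z0))); intros r (a & b & ab & ->).
assert (C : forall u, ex_RInt (Gamma_kernel u) a b).
{ intros u; apply ex_RInt_on_pos; try lra; intros; now apply continuous_Gamma_kernel. }
assert (Le : forall u, 0 < u -> RInt (Gamma_kernel u) a b <= Gamma u).
{ intros u u0; apply (proj1 (proj2 (Gamma_lub u u0))); exists a, b; auto. }
(* The weights normalise the two kernels, so that [p * Gamma x + q * Gamma y = exp c * (s + t) = exp
   c]. *)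
set (p := exp c * s / Gamma x); set (q := exp c * t / Gamma y).
assert (I : is_RInt (fun w => p * Gamma_kernel x w + q * Gamma_kernel y w) a b
              (p * RInt (Gamma_kernel x) a b + q * RInt (Gamma_kernel y) a b)).
{ apply (is_RInt_plus (V := R_NormedModule));
    apply (is_RInt_scal (V := R_NormedModule)), is_RInt_RInt, C. }
assert (gx := Gamma_gt0 x x0); assert (gy := Gamma_gt0 y y0).
apply Rle_trans with (RInt (fun w => p * Gamma_kernel x w + q * Gamma_kernel y w) a b).
- apply RInt_le; try tauto; [apply C | eexists; exact I |].
  intros w Hw.
  assert (F : forall u v, 0 < Gamma u -> exp c * v / Gamma u * Gamma_kernel u w
             = exp c * (v * exp ((u - 1) * ln w - w - lnGamma u))).
  { intros u v gu; unfold Rminus; rewrite 2!exp_plus, (exp_Ropp (lnGamma u)).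
    unfold lnGamma; rewrite exp_ln by auto; unfold Gamma_kernel, Rpower, Rminus; field; lra. }
  unfold p, q; rewrite !F, <- Rmult_plus_distr_l by auto.
  replace (Gamma_kernel z w) with (exp c * exp (s * ((x - 1) * ln w - w - lnGamma x)
                                               + t * ((y - 1) * ln w - w - lnGamma y))).
  + apply Rmult_le_compat_l; [apply Rlt_le, exp_pos | apply exp_convex; lra].
  + rewrite <- exp_plus; unfold Gamma_kernel, Rpower; rewrite <- exp_plus; f_equal.
    unfold c, z; replace t with (1 - s) by lra; ring.
- rewrite (is_RInt_unique _ _ _ _ I).
  assert (0 < exp c) by apply exp_pos.
  assert (p * RInt (Gamma_kernel x) a b <= p * Gamma x).
  { apply Rmult_le_compat_l; auto; apply Rlt_le, Rdiv_lt_0_compat; auto; apply Rmult_lt_0_compat; auto. }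
  assert (q * RInt (Gamma_kernel y) a b <= q * Gamma y).
  { apply Rmult_le_compat_l; auto; apply Rlt_le, Rdiv_lt_0_compat; auto; apply Rmult_lt_0_compat; auto. }
  replace (exp c) with (p * Gamma x + q * Gamma y); [lra |].
  unfold p, q; replace t with (1 - s) by lra; field; lra.
Qed.

Lemma lnGamma_succ (x : R) : 0 < x -> lnGamma (x + 1) = ln x + lnGamma x.
Proof.
intros x0; unfold lnGamma; rewrite Gamma_succ, ln_mult; auto; now apply Gamma_gt0.
Qed.

(** Convexity is used on two triples: [y] lies between [y - 1] and [y + h], and [y + h] between [y]
    and [y + 1]. The functional equation turns the unit increments into [ln (y - 1)] and [ln y]. *)
Lemma lnGamma_increment_bounds (y h : R) : 1 < y -> 0 < h < 1 ->
  h * ln (y - 1) <= lnGamma (y + h) - lnGamma y <= h * ln y.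
Proof.
intros y1 [h0 h1]; split.
- assert (C := lnGamma_convex (h / (1 + h)) (/ (1 + h)) (y - 1) (y + h)).
  assert (0 < / (1 + h)) by (apply Rinv_0_lt_compat; lra).
  replace (h / (1 + h) * (y - 1) + / (1 + h) * (y + h)) with y in C by (field; lra).
  assert (C' : lnGamma y <= h / (1 + h) * lnGamma (y - 1) + / (1 + h) * lnGamma (y + h)).
  { apply C; try lra; [apply Rdiv_lt_0_compat; lra | field; lra]. }
  apply (Rmult_le_compat_l (1 + h)) in C'; [| lra].
  replace ((1 + h) * (h / (1 + h) * lnGamma (y - 1) + / (1 + h) * lnGamma (y + h)))
    with (h * lnGamma (y - 1) + lnGamma (y + h)) in C' by (field; lra).
  assert (E := lnGamma_succ (y - 1) ltac:(lra)).
  replace (y - 1 + 1) with y in E by ring.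
  rewrite E in C' at 1; rewrite E; nra.
- assert (C := lnGamma_convex (1 - h) h y (y + 1)).
  replace ((1 - h) * y + h * (y + 1)) with (y + h) in C by ring.
  rewrite lnGamma_succ in C by lra.
  assert (C' := C ltac:(lra) ltac:(lra) ltac:(lra) ltac:(lra) ltac:(lra)).
  lra.
Qed.

(** * Gauss limits for lnGamma and digamma *)

(** The bound is exclusive, unlike that of [sum_n], so that [psum a (2 * n)] and [psum a (q * J)]
    split into whole blocks. *)
Fixpoint psum (a : nat -> R) (n : nat) : R :=
  match n with 0 => 0 | S m => psum a m + a m end.

Lemma psum_ext (a b : nat -> R) (n : nat) : (forall k, a k = b k) -> psum a n = psum b n.
Proof. intros E; induction n as [| n IH]; simpl; [| rewrite IH, E]; reflexivity. Qed.

Lemma psum_minus (a b : nat -> R) (n : nat) :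
  psum (fun k => a k - b k) n = psum a n - psum b n.
Proof. induction n as [| n IH]; simpl; lra. Qed.

Lemma psum_plus (a b : nat -> R) (n : nat) :
  psum (fun k => a k + b k) n = psum a n + psum b n.
Proof. induction n as [| n IH]; simpl; lra. Qed.

Lemma psum_scal (c : R) (a : nat -> R) (n : nat) : psum (fun k => c * a k) n = c * psum a n.
Proof. induction n as [| n IH]; simpl; lra. Qed.

Lemma psum_le (a b : nat -> R) (n : nat) : (forall k, a k <= b k) -> psum a n <= psum b n.
Proof. intros L; induction n as [| n IH]; simpl; [| assert (A := L n)]; lra. Qed.

Lemma Rabs_psum (a : nat -> R) (n : nat) : Rabs (psum a n) <= psum (fun k => Rabs (a k)) n.
Proof.
induction n as [| n IH]; simpl; [rewrite Rabs_R0; lra |].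
assert (T := Rabs_triang (psum a n) (a n)); lra.
Qed.

Lemma ln_diff_le (u v : R) : 0 < u -> 0 < v -> ln v - ln u <= (v - u) / u.
Proof.
intros u0 v0; assert (w0 : 0 < v / u) by (apply Rdiv_lt_0_compat; auto).
assert (I := exp_ineq1_le (ln (v / u))); rewrite exp_ln in I by auto.
rewrite ln_div in I by auto; replace ((v - u) / u) with (v / u - 1) by (field; lra); lra.
Qed.

Lemma ln_diff_ge (u v : R) : 0 < u -> 0 < v -> (v - u) / v <= ln v - ln u.
Proof.
intros u0 v0; assert (L := ln_diff_le v u v0 u0).
replace ((v - u) / v) with (- ((u - v) / v)) by (field; lra); lra.
Qed.

Lemma is_lim_seq_div_shift (c d : R) : is_lim_seq (fun n => c / (INR n + d)) 0.
Proof.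
replace (Finite 0) with (Rbar_mult c (Rbar_inv p_infty)) by (simpl; f_equal; ring).
apply is_lim_seq_scal_l, is_lim_seq_inv; [| discriminate].
apply (is_lim_seq_plus _ _ p_infty d); [apply is_lim_seq_INR | apply is_lim_seq_const | reflexivity].
Qed.

Lemma is_lim_seq_ln_shift (c : R) : is_lim_seq (fun n => ln (c + INR n) - ln (INR n + 1)) 0.
Proof.
(* [c] may be negative; from [N] on the argument [c + INR n] is positive, and both tangent bounds on
   [ln] apply. *)
destruct (INR_unbounded (1 - c)) as [N HN].
apply is_lim_seq_le_le_loc with (fun n => (c - 1) / (INR n + c)) (fun n => (c - 1) / (INR n + 1));
  try apply is_lim_seq_div_shift.
exists N; intros n Hn; apply le_INR in Hn; assert (n0 := pos_INR n).
replace (c - 1) with ((c + INR n) - (INR n + 1)) by ring; split.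
- rewrite (Rplus_comm (INR n) c); apply ln_diff_ge; lra.
- apply ln_diff_le; lra.
Qed.

Lemma lnGamma_shift (x : R) (n : nat) : 0 < x ->
  lnGamma (x + INR n) = lnGamma x + psum (fun k => ln (x + INR k)) n.
Proof.
intros x0; induction n as [| n IH].
- simpl; rewrite !Rplus_0_r; reflexivity.
- rewrite S_INR; replace (x + (INR n + 1)) with (x + INR n + 1) by ring.
  assert (n0 := pos_INR n).
  rewrite lnGamma_succ, IH by lra; simpl; ring.
Qed.

(* Gauss's product, in increment form: only increments of lnGamma are needed, so no normalisation at 1. *)
Lemma lnGamma_increment_lim (y h : R) : 0 < y -> 0 < h < 1 ->
  is_lim_seq (fun n => h * ln (INR n + 1)
                - psum (fun k => ln (y + h + INR k) - ln (y + INR k)) n)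
             (lnGamma (y + h) - lnGamma y).
Proof.
intros y0 Hh; set (L := lnGamma (y + h) - lnGamma y).
apply is_lim_seq_le_le_loc with
  (fun n => L - h * (ln (y + INR n) - ln (INR n + 1)))
  (fun n => L - h * (ln (y - 1 + INR n) - ln (INR n + 1))).
- exists 2%nat; intros n Hn; apply le_INR in Hn; simpl in Hn.
  rewrite psum_minus.
  assert (E1 := lnGamma_shift (y + h) n ltac:(lra)).
  assert (E2 := lnGamma_shift y n y0).
  assert (B := lnGamma_increment_bounds (y + INR n) h ltac:(lra) Hh).
  replace (y + INR n + h) with (y + h + INR n) in B by ring.
  replace (y + INR n - 1) with (y - 1 + INR n) in B by ring.
  unfold L; lra.
- replace (Finite L) with (Finite (L - h * 0)) by (f_equal; ring).
  apply is_lim_seq_minus'; [apply is_lim_seq_const |].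
  apply (is_lim_seq_scal_l _ h 0), is_lim_seq_ln_shift.
- replace (Finite L) with (Finite (L - h * 0)) by (f_equal; ring).
  apply is_lim_seq_minus'; [apply is_lim_seq_const |].
  apply (is_lim_seq_scal_l _ h 0), is_lim_seq_ln_shift.
Qed.

(** * Uniform slope estimates and the derivative of [lnGamma] *)

Lemma psum_inv_sqr_le (y : R) (n : nat) : 0 < y ->
  psum (fun k => / (y + INR k) ^ 2) n <= / y ^ 2 + / y.
Proof.
intros y0.
(* The first term is set apart; each later one satisfies [/ (u + 1) ^ 2 <= / u - / (u + 1)], and
   these bounds telescope. *)
assert (S : psum (fun k => / (y + INR k) ^ 2) (S n) <= / y ^ 2 + / y - / (y + INR n)).
{ induction n as [| n IH].
  - simpl; rewrite !Rplus_0_r, Rplus_0_l; lra.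
  - change (psum (fun k => / (y + INR k) ^ 2) (S (S n)))
      with (psum (fun k => / (y + INR k) ^ 2) (S n) + / (y + INR (S n)) ^ 2).
    enough (/ (y + INR (S n)) ^ 2 <= / (y + INR n) - / (y + INR (S n))) by lra.
    rewrite S_INR; assert (n0 := pos_INR n); set (u := y + INR n).
    replace (y + (INR n + 1)) with (u + 1) by (unfold u; ring).
    assert (u0 : 0 < u) by (unfold u; lra).
    replace (/ u - / (u + 1)) with (/ (u * (u + 1))) by (field; lra).
    apply Rinv_le_contravar; nra. }
assert (n0 := pos_INR n).
assert (0 < / (y + INR n)) by (apply Rinv_0_lt_compat; lra).
assert (0 < / (y + INR n) ^ 2) by (apply Rinv_0_lt_compat, pow_lt; lra).
simpl psum in S; simpl pow in *; lra.
Qed.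

(** Both quantities lie between [/ (u + h)] and [/ u], whose gap is at most [h / u ^ 2]. Letting [x]
    range over [[y, y + h]] serves left and right increments alike. *)
Lemma ln_slope_approx (x y h u : R) : 0 < u -> 0 < h -> y <= x <= y + h ->
  Rabs ((ln (u + h) - ln u) / h - / (u + (x - y))) <= h * / u ^ 2.
Proof.
intros u0 h0 Hx.
assert (I1 : (ln (u + h) - ln u) / h <= / u).
{ apply Rmult_le_reg_r with h; auto; unfold Rdiv; rewrite Rmult_assoc, Rinv_l, Rmult_1_r by lra.
  assert (L := ln_diff_le u (u + h) u0 ltac:(lra)); unfold Rdiv in L; lra. }
assert (I2 : / (u + h) <= (ln (u + h) - ln u) / h).
{ apply Rmult_le_reg_r with h; auto; unfold Rdiv; rewrite Rmult_assoc, Rinv_l, Rmult_1_r by lra.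
  assert (L := ln_diff_ge u (u + h) u0 ltac:(lra)); unfold Rdiv in L; lra. }
assert (I3 : / (u + (x - y)) <= / u) by (apply Rinv_le_contravar; lra).
assert (I4 : / (u + h) <= / (u + (x - y))) by (apply Rinv_le_contravar; lra).
assert (I5 : / u - / (u + h) <= h * / u ^ 2).
{ replace (/ u - / (u + h)) with (h * / (u * (u + h))) by (field; lra).
  apply Rmult_le_compat_l; [lra |]; apply Rinv_le_contravar; nra. }
apply Rabs_le; lra.
Qed.

Lemma psum_slope_approx (x y h : R) (n : nat) : 0 < y -> 0 < h -> y <= x <= y + h ->
  Rabs (psum (fun k => (ln (y + h + INR k) - ln (y + INR k)) / h - / (x + INR k)) n)
  <= h * (/ y ^ 2 + / y).
Proof.
intros y0 h0 Hx; apply Rle_trans with (1 := Rabs_psum _ _).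
apply Rle_trans with (psum (fun k => h * / (y + INR k) ^ 2) n).
- apply psum_le; intros k; assert (k0 := pos_INR k).
  assert (A := ln_slope_approx x y h (y + INR k) ltac:(lra) h0 Hx).
  replace (y + INR k + h) with (y + h + INR k) in A by ring.
  replace (y + INR k + (x - y)) with (x + INR k) in A by ring; exact A.
- rewrite psum_scal; apply Rmult_le_compat_l; [lra | now apply psum_inv_sqr_le].
Qed.

Lemma psum_slope_split (x y h : R) (n : nat) : 0 < h ->
  ln (INR n + 1) - psum (fun k => / (x + INR k)) n
  = / h * (h * ln (INR n + 1) - psum (fun k => ln (y + h + INR k) - ln (y + INR k)) n)
    + psum (fun k => (ln (y + h + INR k) - ln (y + INR k)) / h - / (x + INR k)) n.
Proof.
intros h0.
rewrite (psum_minus (fun k => (ln (y + h + INR k) - ln (y + INR k)) / h)).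
rewrite (psum_ext (fun k => (ln (y + h + INR k) - ln (y + INR k)) / h)
           (fun k => / h * (ln (y + h + INR k) - ln (y + INR k))))
  by (intros; unfold Rdiv; ring).
rewrite psum_scal; field; lra.
Qed.

(** Gauss's limit with step [/ 2] handles the slope part. The remaining sum decreases, since a chord
    slope of [ln] is at most the derivative at its left end, and the uniform estimate bounds it
    below. *)
Lemma digamma_series_cv (x : R) : 0 < x ->
  exists P : R, is_lim_seq (fun n => ln (INR n + 1) - psum (fun k => / (x + INR k)) n) P.
Proof.
intros x0.
set (r := fun k => (ln (x + / 2 + INR k) - ln (x + INR k)) / / 2 - / (x + INR k)).
destruct (ex_finite_lim_seq_decr (psum r) (- (/ 2 * (/ x ^ 2 + / x)))) as [R HR].
- intros n; simpl; enough (r n <= 0) by lra; unfold r; assert (n0 := pos_INR n).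
  assert (L := ln_diff_le (x + INR n) (x + / 2 + INR n) ltac:(lra) ltac:(lra)).
  replace (x + / 2 + INR n - (x + INR n)) with (/ 2) in L by ring.
  unfold Rdiv in *; rewrite Rinv_inv; lra.
- intros n; assert (A := psum_slope_approx x x (/ 2) n x0 ltac:(lra) ltac:(lra)).
  apply Rabs_le_between in A; apply A.
- exists (/ / 2 * (lnGamma (x + / 2) - lnGamma x) + R).
  apply is_lim_seq_ext with (1 := fun n => eq_sym (psum_slope_split x x (/ 2) n ltac:(lra))).
  apply is_lim_seq_plus'; [| exact HR].
  apply (is_lim_seq_scal_l _ (/ / 2) (Finite _)), lnGamma_increment_lim; lra.
Qed.

(** The estimate of [psum_slope_approx] is uniform in [n], so it survives the passage to the
    limit. *)
Lemma lnGamma_slope_approx (x y h P : R) : 0 < y -> 0 < h < 1 -> y <= x <= y + h ->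
  is_lim_seq (fun n => ln (INR n + 1) - psum (fun k => / (x + INR k)) n) P ->
  Rabs (P - (lnGamma (y + h) - lnGamma y) / h) <= h * (/ y ^ 2 + / y).
Proof.
intros y0 Hh Hx HP.
assert (HE := lnGamma_increment_lim y h y0 Hh).
apply (is_lim_seq_scal_l _ (/ h)) in HE.
assert (HD := is_lim_seq_minus' _ _ _ _ HP HE).
apply is_lim_seq_abs in HD.
assert (Le := fun n => psum_slope_approx x y h n y0 (proj1 Hh) Hx).
set (c := h * (/ y ^ 2 + / y)) in *.
assert (R := fun H => is_lim_seq_le _ (fun _ => c) _ c H HD (is_lim_seq_const c)).
simpl in R; unfold Rdiv; rewrite (Rmult_comm _ (/ h)); apply R.
intros n; rewrite (psum_slope_split x y h n (proj1 Hh)).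
match goal with |- Rabs (?a + ?b - ?a) <= _ => replace (a + b - a) with b by ring end.
apply Le.
Qed.

Lemma is_derive_lnGamma (x P : R) : 0 < x ->
  is_lim_seq (fun n => ln (INR n + 1) - psum (fun k => / (x + INR k)) n) P ->
  is_derive lnGamma x P.
Proof.
intros x0 HP; apply is_derive_Reals; intros eps e0.
(* With [Rabs h < x / 2] every base point is at least [x / 2], so [B] bounds all the error
   constants. *)
set (B := / (x / 2) ^ 2 + / (x / 2)).
assert (B0 : 0 < B).
{ apply Rplus_lt_0_compat; apply Rinv_0_lt_compat; [apply pow_lt |]; lra. }
assert (BB : forall y, x / 2 <= y -> / y ^ 2 + / y <= B).
{ intros y Hy; apply Rplus_le_compat; apply Rinv_le_contravar; try lra; nra. }
assert (d0 : 0 < Rmin (Rmin (x / 2) 1) (eps / B)).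
{ apply Rmin_glb_lt; [apply Rmin_glb_lt; lra | apply Rdiv_lt_0_compat; lra]. }
exists (mkposreal _ d0); intros h h0 Hh; simpl in Hh.
assert (H1 := Rlt_le_trans _ _ _ Hh (Rmin_l _ _)).
assert (H2 := Rlt_le_trans _ _ _ Hh (Rmin_r _ _)).
assert (H3 := Rlt_le_trans _ _ _ H1 (Rmin_l _ _)).
assert (H4 := Rlt_le_trans _ _ _ H1 (Rmin_r _ _)).
assert (H5 : Rabs h * B < eps).
{ replace eps with (eps / B * B) by (field; lra); apply Rmult_lt_compat_r; auto. }
rewrite Rabs_minus_sym.
apply Rle_lt_trans with (2 := H5).
destruct (Rdichotomy h 0 h0) as [hn | hp].
- rewrite (Rabs_left h) in * by auto.
  (* For [h < 0] the increment starts at [x + h], and [x] is its right end. *)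
  assert (A := lnGamma_slope_approx x (x + h) (- h) P ltac:(lra) ltac:(lra) ltac:(lra) HP).
  replace (x + h + - h) with x in A by ring.
  replace ((lnGamma x - lnGamma (x + h)) / - h) with ((lnGamma (x + h) - lnGamma x) / h) in A
    by (field; lra).
  apply Rle_trans with (1 := A), Rmult_le_compat_l; [lra | apply BB; lra].
- rewrite (Rabs_right h) in * by lra.
  assert (A := lnGamma_slope_approx x x h P ltac:(lra) ltac:(lra) ltac:(lra) HP).
  apply Rle_trans with (1 := A), Rmult_le_compat_l; [lra | apply BB; lra].
Qed.

(** [digamma] is built on [Derive Gamma]; near [x], [Gamma] is [exp] of [lnGamma], so its derivative
    is [P * Gamma x]. *)
Lemma digamma_lim (x : R) : 0 < x ->
  is_lim_seq (fun n => ln (INR n + 1) - psum (fun k => / (x + INR k)) n) (digamma x).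
Proof.
intros x0; destruct (digamma_series_cv x x0) as [P HP].
replace (digamma x) with P; [exact HP |].
assert (D : is_derive Gamma x (P * Gamma x)).
{ apply (is_derive_ext_loc (fun t => exp (lnGamma t))).
  - exists (mkposreal x x0); intros t Ht.
    apply ball_R in Ht; simpl in Ht; unfold lnGamma; apply exp_ln, Gamma_gt0; lra.
  - replace (Gamma x) with (exp (lnGamma x)) by (apply exp_ln, Gamma_gt0, x0).
    apply (is_derive_comp exp lnGamma); [apply is_derive_exp | now apply is_derive_lnGamma]. }
unfold digamma; rewrite (is_derive_unique _ _ _ D); field.
assert (g := Gamma_gt0 x x0); lra.
Qed.

(** * The alternating series as a combination of Gauss limits *)

Definition alt_gamma_coef (q j : nat) : R := (-1) ^ j * gamma_coef (q * j).

Lemma psum_double (a : nat -> R) (n : nat) :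
  psum a (2 * n) = psum (fun i => a (2 * i)%nat + a (2 * i + 1)%nat) n.
Proof.
induction n as [| n IH]; [reflexivity |].
replace (2 * S n)%nat with (S (S (2 * n))) by lia.
cbn [psum]; rewrite IH; replace (2 * n + 1)%nat with (S (2 * n)) by lia; ring.
Qed.

(** The integers [q * j + 1] and [q * j + 2] are [(a + i) / a] and [(a + a + i) / a] for
    [j = 2 * i], and [(b + i) / a] and [(b + a + i) / a] for [j = 2 * i + 1]. The factor [/ a]
    cancels inside each logarithm of a quotient. *)
Lemma alt_gamma_coef_pair (q i : nat) : (0 < q)%nat ->
  let a := / (2 * INR q) in let b := a + / 2 in
  alt_gamma_coef q (2 * i) + alt_gamma_coef q (2 * i + 1)
  = a * (/ (a + INR i) - / (b + INR i)) - (ln (a + a + INR i) - ln (a + INR i))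
    + (ln (b + a + INR i) - ln (b + INR i)).
Proof.
intros hq a b; apply lt_INR in hq; simpl in hq; assert (i0 := pos_INR i).
assert (a0 : 0 < a) by (apply Rinv_0_lt_compat; lra).
unfold alt_gamma_coef, gamma_coef.
rewrite pow_add, pow_1, pow_1_even, !mult_INR, plus_INR, mult_INR; simpl (INR 2); simpl (INR 1).
assert (Q : INR q = / (2 * a)) by (unfold a; field; lra).
set (t := INR i) in *; rewrite Q.
assert (D : / (2 * a) * (2 * t) = / a * t) by (field; lra).
assert (D' : / (2 * a) * (2 * t + 1) = / a * (t + / 2)) by (field; lra).
replace (1 + 1) with 2 by ring; rewrite D, D'.
assert (ia : 0 < / a) by (apply Rinv_0_lt_compat; lra).
replace (/ a * t + 1) with (/ a * (a + t)) by (field; lra).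
replace (/ a * t + 2) with (/ a * (a + a + t)) by (field; lra).
replace (/ a * (t + / 2) + 1) with (/ a * (b + t)) by (unfold b; field; lra).
replace (/ a * (t + / 2) + 2) with (/ a * (b + a + t)) by (unfold b; field; lra).
assert (b0 : 0 < b) by (unfold b; lra).
rewrite !ln_div, !ln_mult by (try apply Rmult_lt_0_compat; lra).
field; lra.
Qed.

(** The terms [ln (INR n + 1)] cancel in the difference of the two digamma limits, and also in that
    of the two increments, both of step [a]. *)
Lemma alt_gamma_coef_lim (q : nat) : (0 < q)%nat ->
  is_lim_seq (fun n => psum (alt_gamma_coef q) (2 * n))
    (1 / (2 * INR q) *
             (digamma ((INR q + 1) / (2 * INR q)) - digamma (1 / (2 * INR q)))
           - ln ((Gamma (1 / (2 * INR q)) * Gamma ((INR q + 2) / (2 * INR q)))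
                 / (Gamma (1 / INR q) * Gamma ((INR q + 1) / (2 * INR q))))).
Proof.
intros hq; assert (q1 : 1 <= INR q) by (apply (le_INR 1); lia).
set (a := / (2 * INR q)); set (b := a + / 2).
replace ((INR q + 1) / (2 * INR q)) with b by (unfold b, a; field; lra).
replace ((INR q + 2) / (2 * INR q)) with (b + a) by (unfold b, a; field; lra).
replace (1 / INR q) with (a + a) by (unfold a; field; lra).
replace (1 / (2 * INR q)) with a by (unfold a; field; lra).
assert (a0 : 0 < a) by (apply Rinv_0_lt_compat; lra).
assert (a1 : a < 1).
{ unfold a; rewrite <- Rinv_1; apply Rinv_lt_contravar; lra. }
assert (b0 : 0 < b) by (unfold b; lra).
assert (G := fun x (x0 : 0 < x) => Gamma_gt0 x x0).
rewrite ln_div by (apply Rmult_lt_0_compat; apply G; lra).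
rewrite !ln_mult by (apply G; lra).
fold (lnGamma a) (lnGamma b) (lnGamma (b + a)) (lnGamma (a + a)).
replace (a * (digamma b - digamma a) - (lnGamma a + lnGamma (b + a) - (lnGamma (a + a) + lnGamma b)))
  with (a * (digamma b - digamma a) + ((lnGamma (a + a) - lnGamma a) - (lnGamma (b + a) - lnGamma b)))
  by ring.
assert (L1 := is_lim_seq_minus' _ _ _ _ (digamma_lim b b0) (digamma_lim a a0)).
apply (is_lim_seq_scal_l _ a) in L1.
assert (L2 := is_lim_seq_minus' _ _ _ _ (lnGamma_increment_lim a a a0 ltac:(lra))
               (lnGamma_increment_lim b a b0 ltac:(lra))).
apply is_lim_seq_ext with (2 := is_lim_seq_plus' _ _ _ _ L1 L2).
intros n; rewrite psum_double.
rewrite (psum_ext _ _ n (fun i => alt_gamma_coef_pair q i hq)).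
fold a; fold b.
rewrite psum_plus, !psum_minus, psum_scal, psum_minus; ring.
Qed.

(** * The average of the gamma series *)

Lemma gamma_coef_bounds (m : nat) : 0 <= gamma_coef m <= / (INR m + 1) - / (INR m + 2).
Proof.
unfold gamma_coef; assert (m0 := pos_INR m); rewrite ln_div by lra.
assert (U := ln_diff_le (INR m + 1) (INR m + 2) ltac:(lra) ltac:(lra)).
assert (L := ln_diff_ge (INR m + 1) (INR m + 2) ltac:(lra) ltac:(lra)).
replace (INR m + 2 - (INR m + 1)) with 1 in U, L by ring; unfold Rdiv in U, L; lra.
Qed.

Lemma psum_sum_n (a : nat -> R) (n : nat) : psum a (S n) = sum_n a n.
Proof.
induction n as [| n IH].
- rewrite sum_O; simpl; ring.
- rewrite sum_Sn, <- IH; reflexivity.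
Qed.

Lemma is_series_psum (a : nat -> R) (l : R) : is_series a l <-> is_lim_seq (psum a) l.
Proof.
rewrite is_lim_seq_incr_1; split; intros H.
- apply is_lim_seq_ext with (2 := H); intros n; symmetry; apply psum_sum_n.
- exact (is_lim_seq_ext _ _ l (psum_sum_n a) H).
Qed.

(** The upper bounds on the coefficients telescope, so the partial sums stay below [1]. *)
Lemma ex_series_gamma_coef : ex_series gamma_coef.
Proof.
destruct (ex_finite_lim_seq_incr (psum gamma_coef) 1) as [l Hl].
- intros n; simpl; assert (B := gamma_coef_bounds n); lra.
- intros n; enough (psum gamma_coef n <= 1 - / (INR n + 1)).
  { assert (n0 := pos_INR n); assert (0 < / (INR n + 1)) by (apply Rinv_0_lt_compat; lra); lra. }
  induction n as [| n IH]; [simpl; rewrite Rplus_0_l, Rinv_1; lra |].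
  rewrite S_INR; assert (B := gamma_coef_bounds n); simpl.
  replace (INR n + 1 + 1) with (INR n + 2) by ring; lra.
- exists l; now apply is_series_psum.
Qed.

Lemma ex_series_bounded_gamma_coef (c : nat -> R) :
  (forall m, -1 <= c m <= 1) -> ex_series (fun m => c m * gamma_coef m).
Proof.
intros Hc; apply (@ex_series_le R_AbsRing R_CompleteNormedModule _ gamma_coef);
  [| exact ex_series_gamma_coef].
intros m; change (Rabs (c m * gamma_coef m) <= gamma_coef m).
assert (B := gamma_coef_bounds m); rewrite Rabs_mult, (Rabs_right (gamma_coef m)) by lra.
assert (Rabs (c m) <= 1) by (apply Rabs_le, Hc); nra.
Qed.

(** * Sums over the odd powers of [omega] *)

Lemma Cpow_cos_sin (t : R) (n : nat) : Cpow (cos t, sin t) n = (cos (INR n * t), sin (INR n * t)).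
Proof.
induction n as [| n IH]; [simpl; rewrite Rmult_0_l, cos_0, sin_0; reflexivity |].
rewrite Cpow_S, IH, S_INR, Rmult_plus_distr_r, Rmult_1_l, cos_plus, sin_plus.
unfold Cmult; simpl; f_equal; ring.
Qed.

Lemma sum_n_pair (u v : nat -> R) (n : nat) :
  sum_n (fun k => (u k, v k) : C) n = (psum u (S n), psum v (S n)).
Proof.
induction n as [| n IH].
- rewrite sum_O; simpl; rewrite !Rplus_0_l; reflexivity.
- rewrite sum_Sn, IH; reflexivity.
Qed.

Lemma is_series_psum_swap (u : nat -> nat -> R) (N : nat) : (forall k, ex_series (u k)) ->
  is_series (fun m => psum (fun k => u k m) N) (psum (fun k => Series (u k)) N).
Proof.
intros E; induction N as [| N IH]; simpl.
- apply is_series_psum.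
  apply is_lim_seq_ext with (fun _ => 0); [| apply is_lim_seq_const].
  intros n; induction n as [| n IH]; simpl; lra.
- apply (is_series_plus (V := R_NormedModule)); [exact IH | apply Series_correct, E].
Qed.

(** The factor [2 * sin t] turns each cosine into a difference of sines at consecutive even
    multiples of [t], so the sum telescopes. *)
Lemma psum_cos_odd (t : R) (n : nat) :
  2 * sin t * psum (fun k => cos ((2 * INR k + 1) * t)) n = sin (2 * INR n * t).
Proof.
induction n as [| n IH]; [simpl; rewrite !Rmult_0_r, Rmult_0_l, sin_0; reflexivity |].
rewrite S_INR; simpl; rewrite Rmult_plus_distr_l, IH.
replace (2 * (INR n + 1) * t) with ((2 * INR n + 1) * t + t) by ring.
replace (2 * INR n * t) with ((2 * INR n + 1) * t - t) by ring.
rewrite sin_plus, sin_minus; ring.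
Qed.

Lemma psum_sin_odd (t : R) (n : nat) :
  2 * sin t * psum (fun k => sin ((2 * INR k + 1) * t)) n = 1 - cos (2 * INR n * t).
Proof.
induction n as [| n IH]; [simpl; rewrite !Rmult_0_r, Rmult_0_l, cos_0; ring |].
rewrite S_INR; simpl; rewrite Rmult_plus_distr_l, IH.
replace (2 * (INR n + 1) * t) with ((2 * INR n + 1) * t + t) by ring.
replace (2 * INR n * t) with ((2 * INR n + 1) * t - t) by ring.
rewrite cos_plus, cos_minus; ring.
Qed.

Lemma cos_sin_plus_INR_PI (x : R) (n : nat) :
  cos (x + INR n * PI) = (-1) ^ n * cos x /\ sin (x + INR n * PI) = (-1) ^ n * sin x.
Proof.
induction n as [| n [IHc IHs]].
- simpl; rewrite Rmult_0_l, Rplus_0_r; lra.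
- rewrite S_INR; replace (x + (INR n + 1) * PI) with (x + INR n * PI + PI) by ring.
  rewrite neg_cos, neg_sin, IHc, IHs; simpl; lra.
Qed.

(** The angle [t] is [i * PI / q] plus a multiple of [PI], with [0 < i < q], so [sin t] is nonzero,
    while [2 * q * t] is a multiple of [2 * PI]: both telescoped sums vanish. *)
Lemma psum_trig_not_dvd (q J i : nat) : (0 < i < q)%nat ->
  psum (fun k => cos ((2 * INR k + 1) * (INR (q * J + i) * (PI / INR q)))) q = 0 /\
  psum (fun k => sin ((2 * INR k + 1) * (INR (q * J + i) * (PI / INR q)))) q = 0.
Proof.
intros [i0 iq]; apply lt_INR in i0, iq; simpl in i0.
set (t := INR (q * J + i) * (PI / INR q)).
assert (Et : t = INR i * (PI / INR q) + INR J * PI).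
{ unfold t; rewrite plus_INR, mult_INR; field; lra. }
assert (E2 : 2 * INR q * t = 0 + INR (2 * (q * J + i)) * PI).
{ unfold t; rewrite mult_INR; simpl (INR 2); field; lra. }
assert (pi0 := PI_RGT_0).
assert (S : sin t <> 0).
{ rewrite Et, (proj2 (cos_sin_plus_INR_PI _ J)).
  apply Rmult_integral_contrapositive_currified; [apply pow_nonzero; lra |].
  apply Rgt_not_eq, sin_gt_0.
  - apply Rmult_lt_0_compat; auto; apply Rdiv_lt_0_compat; lra.
  - replace PI with (INR q * (PI / INR q)) at 2 by (field; lra).
    apply Rmult_lt_compat_r; auto; apply Rdiv_lt_0_compat; lra. }
assert (C := psum_cos_odd t q); assert (D := psum_sin_odd t q).
rewrite E2, (proj2 (cos_sin_plus_INR_PI _ _)), sin_0, Rmult_0_r in C.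
rewrite E2, (proj1 (cos_sin_plus_INR_PI _ _)), cos_0, pow_1_even in D.
split; apply Rmult_eq_reg_l with (2 * sin t); try lra.
Qed.

Lemma psum_const (c : R) (n : nat) : psum (fun _ => c) n = INR n * c.
Proof. induction n as [| n IH]; [simpl; ring | rewrite S_INR; simpl; rewrite IH; ring]. Qed.

(** The angles are [(2 * k + 1) * J * PI], and [(2 * k + 1) * J] has the parity of [J]. *)
Lemma psum_trig_dvd (q J : nat) : (0 < q)%nat ->
  psum (fun k => cos ((2 * INR k + 1) * (INR (q * J) * (PI / INR q)))) q = INR q * (-1) ^ J /\
  psum (fun k => sin ((2 * INR k + 1) * (INR (q * J) * (PI / INR q)))) q = 0.
Proof.
intros q0; apply lt_INR in q0; simpl in q0.
assert (E : forall k, (2 * INR k + 1) * (INR (q * J) * (PI / INR q))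
                      = 0 + INR ((2 * k + 1) * J) * PI).
{ intros k; rewrite !mult_INR, plus_INR, mult_INR; simpl (INR 2); simpl (INR 1); field; lra. }
split.
- rewrite <- (psum_const ((-1) ^ J)); apply psum_ext; intros k.
  rewrite E, (proj1 (cos_sin_plus_INR_PI _ _)), cos_0, Rmult_1_r, pow_mult, pow_add, pow_1_even.
  f_equal; ring.
- rewrite <- (Rmult_0_r (INR q)), <- (psum_const 0); apply psum_ext; intros k.
  rewrite E, (proj2 (cos_sin_plus_INR_PI _ _)), sin_0; ring.
Qed.

Lemma psum_add (a : nat -> R) (n r : nat) :
  psum a (n + r) = psum a n + psum (fun i => a (n + i)%nat) r.
Proof.
induction r as [| r IH]; [rewrite Nat.add_0_r; simpl; ring |].
rewrite Nat.add_succ_r; simpl; rewrite IH; ring.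
Qed.

Lemma psum_head (b : nat -> R) (n : nat) : (0 < n)%nat ->
  (forall i, (0 < i < n)%nat -> b i = 0) -> psum b n = b 0%nat.
Proof.
intros n0; induction n as [| n IH]; [lia |]; intros Z.
destruct n as [| n]; [simpl; ring |].
change (psum b (S (S n))) with (psum b (S n) + b (S n)).
rewrite IH, (Z (S n)); try lia; [ring |]; intros i Hi; apply Z; lia.
Qed.

Lemma psum_multiples (a : nat -> R) (q J : nat) : (0 < q)%nat ->
  (forall j i, (0 < i < q)%nat -> a (q * j + i)%nat = 0) ->
  psum a (q * J) = psum (fun j => a (q * j)%nat) J.
Proof.
intros q0 Z; induction J as [| J IH]; [rewrite Nat.mul_0_r; reflexivity |].
rewrite Nat.mul_succ_r, psum_add, IH; simpl; f_equal.
rewrite psum_head; auto; rewrite Nat.add_0_r; reflexivity.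
Qed.

Lemma filterlim_eventually_ge (phi : nat -> nat) : (forall n, (n <= phi n)%nat) ->
  filterlim phi eventually eventually.
Proof. intros H P [N HN]; exists N; intros n Hn; apply HN; specialize (H n); lia. Qed.

Lemma mean_gamma_series (q : nat) (I : R) : (0 < q)%nat ->
  is_lim_seq (fun n => psum (alt_gamma_coef q) (2 * n)) I ->
  Cmult (RtoC (/ INR q))
        (sum_n (fun k => gamma_series (Cpow (omega q) (2 * k + 1))) (q - 1)) = RtoC I.
Proof.
intros q0 HI.
set (u := fun k m => cos ((2 * INR k + 1) * (INR m * (PI / INR q))) * gamma_coef m).
set (v := fun k m => sin ((2 * INR k + 1) * (INR m * (PI / INR q))) * gamma_coef m).
assert (E : forall k, gamma_series (Cpow (omega q) (2 * k + 1)) = (Series (u k), Series (v k))).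
{ intros k; unfold gamma_series, omega; f_equal; apply Series_ext; intros m;
    rewrite <- Cpow_mult_r, Cpow_cos_sin; unfold u, v, Re, Im; cbn [fst snd];
    rewrite mult_INR, plus_INR, mult_INR; simpl (INR 2); simpl (INR 1);
    do 2 f_equal; ring. }
rewrite (sum_n_ext _ _ (q - 1) E), sum_n_pair.
replace (S (q - 1)) with q by lia.
assert (U := is_series_psum_swap u q (fun k => ex_series_bounded_gamma_coef _ (fun m => COS_bound _))).
assert (V := is_series_psum_swap v q (fun k => ex_series_bounded_gamma_coef _ (fun m => SIN_bound _))).
apply is_series_psum in U; apply is_series_psum in V.
(* Cutting at [q * (2 * n)] splits the range into whole blocks of length [q], in even number as in
   [HI]. *)
assert (F : filterlim (fun n => q * (2 * n))%nat eventually eventually)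
  by (apply filterlim_eventually_ge; intros; nia).
apply (is_lim_seq_subseq _ _ _ F) in U; apply (is_lim_seq_subseq _ _ _ F) in V.
assert (D : forall f m, psum (fun k => f k * gamma_coef m) q = psum f q * gamma_coef m).
{ intros f m; rewrite Rmult_comm, <- psum_scal; apply psum_ext; intros; ring. }
assert (EU : psum (fun k => Series (u k)) q = INR q * I).
{ assert (U' : is_lim_seq (fun n => INR q * psum (alt_gamma_coef q) (2 * n)) (INR q * I))
    by apply (is_lim_seq_scal_l _ (INR q) I HI).
  apply is_lim_seq_unique in U; apply is_lim_seq_unique in U'.
  enough (W : Finite (psum (fun k => Series (u k)) q) = Finite (INR q * I)) by now injection W.
  rewrite <- U, <- U'; apply Lim_seq_ext; intros n.
  rewrite psum_multiples; auto.
  - rewrite <- psum_scal; apply psum_ext; intros j; unfold u.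
    rewrite D, (proj1 (psum_trig_dvd q j q0)); unfold alt_gamma_coef; ring.
  - intros j i Hi; unfold u; rewrite D, (proj1 (psum_trig_not_dvd q j i Hi)); ring. }
assert (EV : psum (fun k => Series (v k)) q = 0).
{ apply is_lim_seq_unique in V.
  enough (W : Finite (psum (fun k => Series (v k)) q) = Finite 0) by now injection W.
  rewrite <- V, <- (Lim_seq_const 0); apply Lim_seq_ext; intros n.
  rewrite psum_multiples; auto.
  - rewrite <- (Rmult_0_r (INR (2 * n))), <- (psum_const 0); apply psum_ext; intros j; unfold v.
    rewrite D, (proj2 (psum_trig_dvd q j q0)); ring.
  - intros j i Hi; unfold v; rewrite D, (proj2 (psum_trig_not_dvd q j i Hi)); ring. }
rewrite EU, EV; apply lt_INR in q0; simpl in q0.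
unfold Cmult, RtoC; simpl; f_equal; field; lra.
Qed.

(** * The inner integrals *)

(* Since [ln u = 0] for [u <= 0] and [/ 0 = 0], [phi] vanishes there and is continuous on (-oo, 1). *)
Definition phi (u : R) : R := / (- ln u).

Lemma ln_nonpos_arg (u : R) : u <= 0 -> ln u = 0.
Proof. intros u0; unfold ln; destruct (Rlt_dec 0 u); [exfalso; lra | reflexivity]. Qed.

Lemma phi_nonpos_arg (u : R) : u <= 0 -> phi u = 0.
Proof. intros u0; unfold phi; rewrite ln_nonpos_arg, Ropp_0; auto; apply Rinv_0. Qed.

Lemma opp_ln_ge (u : R) : 0 < u -> 1 - u <= - ln u.
Proof. intros u0; assert (L := ln_diff_le 1 u Rlt_0_1 u0); rewrite ln_1 in L; lra. Qed.

Lemma opp_ln_le (u : R) : 0 < u -> - ln u <= (1 - u) / u.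
Proof.
intros u0; assert (L := ln_diff_le u 1 u0 Rlt_0_1); rewrite ln_1 in L; lra.
Qed.

Lemma phi_ge0 (u : R) : u < 1 -> 0 <= phi u.
Proof.
intros u1; destruct (Rle_lt_dec u 0); [rewrite phi_nonpos_arg; lra |].
apply Rlt_le, Rinv_0_lt_compat; assert (L := opp_ln_ge u ltac:(lra)); lra.
Qed.

Lemma phi_le (u v : R) : u <= v -> v < 1 -> phi u <= phi v.
Proof.
intros uv v1; destruct (Rle_lt_dec u 0).
- rewrite (phi_nonpos_arg u) by auto; now apply phi_ge0.
- apply Rinv_le_contravar.
  + assert (L := opp_ln_ge v ltac:(lra)); lra.
  + apply Ropp_le_contravar, ln_le; auto.
Qed.

Lemma phi_le_inv (u : R) : u < 1 -> phi u <= / (1 - u).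
Proof.
intros u1; destruct (Rle_lt_dec u 0).
- rewrite phi_nonpos_arg by auto; apply Rlt_le, Rinv_0_lt_compat; lra.
- apply Rinv_le_contravar; [lra | apply opp_ln_ge; auto].
Qed.

(** For [u > 0] this is the logarithm of a power; at [u = 0] and [u = 1] both sides are [0] because
    [/ 0 = 0]. A negative [u] is set apart since its even powers are positive. *)
Lemma phi_pow (u : R) (n : nat) : INR (S n) * phi (u ^ S n) = phi u \/ u < 0.
Proof.
destruct (Rle_lt_dec u 0) as [[u0 | ->] | u0]; [right; auto | |]; left.
- rewrite !phi_nonpos_arg; try ring; try lra; rewrite pow_i by lia; lra.
- unfold phi; rewrite ln_pow by auto.
  assert (n0 := pos_INR n); assert (INR (S n) <> 0) by (rewrite S_INR; lra).
  destruct (Req_dec (ln u) 0) as [-> | L]; [rewrite Rmult_0_r, Ropp_0, Rinv_0; ring | field; auto].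
Qed.

Lemma continuous_phi (u : R) : u < 1 -> continuous phi u.
Proof.
intros u1; destruct (Rtotal_order u 0) as [u0 | [-> | u0]].
- apply (continuous_ext_loc phi (fun _ => 0) u); [| apply continuous_const].
  exists (mkposreal (- u) ltac:(lra)); intros v Hv.
  apply ball_R in Hv; simpl in Hv; symmetry; apply phi_nonpos_arg; lra.
- intros P [eps HP]; rewrite phi_nonpos_arg in HP by lra.
  (* Within this radius a positive [v] has [- ln v > / eps], hence [phi v < eps]. *)
  exists (mkposreal (exp (- (/ eps + 1))) (exp_pos _)); intros v Hv; apply HP.
  unfold ball in *; simpl in *; unfold AbsRing_ball, abs, minus, plus, opp in *; simpl in *.
  assert (e0 := cond_pos eps).
  assert (ie : 0 < / eps) by (apply Rinv_0_lt_compat; auto).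
  apply Rabs_def2 in Hv; destruct (Rle_lt_dec v 0).
  + rewrite phi_nonpos_arg by auto; apply Rabs_def1; lra.
  + assert (L : ln v < - (/ eps + 1)) by (rewrite <- ln_exp; apply ln_increasing; lra).
    assert (phi v < eps).
    { unfold phi; rewrite <- (Rinv_inv eps); apply Rinv_lt_contravar; [apply Rmult_lt_0_compat |]; lra. }
    assert (0 < phi v) by (apply Rinv_0_lt_compat; lra).
    apply Rabs_def1; lra.
- apply (ex_derive_continuous phi u); unfold phi; auto_derive.
  assert (L := opp_ln_ge u u0); repeat split; auto; lra.
Qed.

(** The [A] of the overview, which on [[0, 1)] is minus the logarithmic integral and diverges at
    [1]. *)
Definition phi_int (y : R) : R := RInt phi 0 y.

Lemma ex_RInt_phi (a b : R) : a < 1 -> b < 1 -> ex_RInt phi a b.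
Proof.
intros a1 b1; apply (@ex_RInt_continuous R_CompleteNormedModule).
intros t [_ Ht]; apply continuous_phi; apply Rle_lt_trans with (1 := Ht), Rmax_lub_lt; auto.
Qed.

Lemma is_derive_phi_int (y : R) : y < 1 -> is_derive phi_int y (phi y).
Proof.
intros y1; apply (is_derive_RInt phi phi_int 0); [| now apply continuous_phi].
exists (mkposreal (1 - y) ltac:(lra)); intros v Hv.
  apply ball_R in Hv; simpl in Hv; apply is_RInt_RInt, ex_RInt_phi; lra.
Qed.

Lemma phi_int_0 : phi_int 0 = 0.
Proof. apply (RInt_point (V := R_CompleteNormedModule)). Qed.

Lemma phi_int_diff (a b : R) : a < 1 -> b < 1 -> phi_int b - phi_int a = RInt phi a b.
Proof.
intros a1 b1; unfold phi_int.
assert (E : RInt phi 0 a + RInt phi a b = RInt phi 0 b).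
{ apply (RInt_Chasles phi); apply ex_RInt_phi; lra. }
lra.
Qed.

Lemma phi_int_le (a b : R) : a <= b -> b < 1 -> phi_int a <= phi_int b.
Proof.
intros ab b1; enough (0 <= RInt phi a b) by (rewrite <- phi_int_diff in H; lra).
apply RInt_ge_0; [| apply ex_RInt_phi | intros; apply phi_ge0]; lra.
Qed.

Lemma phi_int_ge0 (y : R) : 0 <= y < 1 -> 0 <= phi_int y.
Proof. intros Hy; rewrite <- phi_int_0; apply phi_int_le; lra. Qed.

Lemma phi_int_le_mul (y : R) : 0 <= y < 1 -> phi_int y <= y * phi y.
Proof.
intros Hy; replace (y * phi y) with (RInt (fun _ => phi y) 0 y).
- apply RInt_le; [lra | apply ex_RInt_phi; lra | apply ex_RInt_const |].
  intros x Hx; apply phi_le; lra.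
- rewrite RInt_const; unfold scal; simpl; unfold mult; simpl; ring.
Qed.

Lemma phi_int_le_ln (y : R) : 0 <= y < 1 -> phi_int y <= - ln (1 - y).
Proof.
intros Hy.
assert (I : is_RInt (fun u => / (1 - u)) 0 y (- ln (1 - y) - - ln (1 - 0))).
{ apply (is_RInt_derive (fun u => - ln (1 - u))); intros u [_ Hu]; rewrite Rmax_right in Hu by lra.
  - auto_derive; [lra | field; lra].
  - apply (ex_derive_continuous (fun u => / (1 - u)) u); auto_derive; lra. }
replace (- ln (1 - y)) with (- ln (1 - y) - - ln (1 - 0)) by (rewrite Rminus_0_r, ln_1; ring).
rewrite <- (is_RInt_unique _ _ _ _ I).
apply RInt_le; [lra | apply ex_RInt_phi; lra | eexists; exact I |].
intros u Hu; apply phi_le_inv; lra.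
Qed.

(** With [s = sqrt (1 - y)] the logarithmic bound on [phi_int y] is [- 2 * ln s <= 2 * (1 - s) / s],
    and the factor [s ^ 2] leaves at most [2 * s]. So [1 - y] beats the divergence of [phi_int] at
    [1]. *)
Lemma phi_int_near_1 (y : R) : 0 <= y < 1 -> (1 - y) * phi_int y <= 2 * sqrt (1 - y).
Proof.
intros Hy; set (s := sqrt (1 - y)).
assert (s0 : 0 < s) by (apply sqrt_lt_R0; lra).
assert (E : 1 - y = s * s) by (symmetry; apply sqrt_sqrt; lra).
assert (L := phi_int_le_ln y Hy); rewrite E, ln_mult in L by auto.
assert (M := opp_ln_le s s0).
assert (s * s * phi_int y <= s * s * (2 * ((1 - s) / s))).
{ apply Rmult_le_compat_l; [apply Rlt_le, Rmult_lt_0_compat |]; lra. }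
rewrite E; apply Rle_trans with (1 := H).
replace (s * s * (2 * ((1 - s) / s))) with (2 * s * (1 - s)) by (field; lra); nra.
Qed.

Lemma pow_in_01 (y : R) (n : nat) : 0 < y < 1 -> 0 < y ^ S n <= y.
Proof.
intros Hy; split; [apply pow_lt; lra |].
simpl; rewrite <- (Rmult_1_r y) at 3; apply Rmult_le_compat_l; [lra |].
rewrite <- (pow1 n); apply pow_incr; lra.
Qed.

(* [fun v => - ln (- ln v)] is a primitive of [phi v / v], whose increment between two powers of y
   does not depend on y. *)
Lemma phi_int_pow_diff (y : R) (m : nat) : 0 < y < 1 ->
  let X := ln ((INR m + 2) / (INR m + 1)) in
  y ^ (m + 2) * X <= phi_int (y ^ (m + 1)) - phi_int (y ^ (m + 2)) <= X.
Proof.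
intros Hy X; assert (m0 := pos_INR m).
set (a := y ^ (m + 2)); set (b := y ^ (m + 1)).
assert (a0 : 0 < a) by (apply pow_lt; lra).
assert (b1 : b < 1).
{ unfold b; replace (m + 1)%nat with (S m) by lia; assert (P := pow_in_01 y m Hy); lra. }
assert (ab : a <= b).
{ unfold a, b; replace (m + 2)%nat with (S (m + 1)) by lia; simpl.
  rewrite <- (Rmult_1_l (y ^ (m + 1))) at 2; apply Rmult_le_compat_r; [apply pow_le |]; lra. }
assert (I : is_RInt (fun v => phi v / v) a b X).
{ replace X with (- ln (- ln b) - - ln (- ln a)).
  - apply (is_RInt_derive (fun v => - ln (- ln v))); intros v Hv;
      rewrite Rmin_left, Rmax_right in Hv by auto;
      assert (L := opp_ln_ge v ltac:(lra)).
    + unfold phi; auto_derive; [repeat split; lra | field; lra].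
    + apply (ex_derive_continuous (fun v => phi v / v) v); unfold phi; auto_derive; repeat split; lra.
  - assert (L := opp_ln_ge y ltac:(lra)).
    unfold a, b, X; rewrite !ln_pow, ln_div by lra.
    rewrite !plus_INR; simpl (INR 2); simpl (INR 1).
    rewrite !Ropp_mult_distr_r, !ln_mult by lra; replace (1 + 1) with 2 by ring; ring. }
rewrite phi_int_diff by lra; rewrite <- (is_RInt_unique _ _ _ _ I); split.
- replace (a * RInt (fun v => phi v / v) a b) with (RInt (fun v => a * (phi v / v)) a b).
  + apply RInt_le; auto.
    * apply (ex_RInt_scal (V := R_NormedModule)); eexists; exact I.
    * apply ex_RInt_phi; lra.
    * intros v Hv; assert (P := phi_ge0 v ltac:(lra)).
      apply Rmult_le_reg_r with v; [lra |].
      replace (a * (phi v / v) * v) with (a * phi v) by (field; lra); nra.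
  + apply (RInt_scal (V := R_CompleteNormedModule)); eexists; exact I.
- apply RInt_le; auto; [apply ex_RInt_phi; lra | eexists; exact I |].
  intros v Hv; assert (P := phi_ge0 v ltac:(lra)).
  apply Rmult_le_reg_r with v; [lra |].
  replace (phi v / v * v) with (phi v) by (field; lra); nra.
Qed.

(** * The inner integral in closed form and its primitive in [y] *)

Definition inner (m : nat) (y : R) : R :=
  phi_int (y ^ (m + 1)) / y - phi_int (y ^ (m + 2)) / y ^ 2.

(** The chain rule produces [(m + 1) * u ^ m * phi (u ^ (m + 1))], which [phi_pow] collapses; the
    value [phi 0 = 0] lets the formula include [u = 0]. *)
Lemma is_derive_phi_int_pow (m : nat) (u : R) : 0 <= u < 1 ->
  is_derive (fun u => phi_int (u ^ (m + 1))) u (phi u * u ^ m).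
Proof.
intros Hu; replace (m + 1)%nat with (S m) by lia.
assert (E : phi u * u ^ m = (INR (S m) * u ^ m) * phi (u ^ S m)).
{ destruct (phi_pow u m) as [<- |]; [ring | lra]. }
rewrite E; apply (is_derive_comp phi_int (fun u => u ^ S m)).
- apply is_derive_phi_int; apply Rle_lt_trans with u; [| lra].
  simpl; rewrite <- (Rmult_1_r u) at 3; apply Rmult_le_compat_l; [lra |].
  rewrite <- (pow1 m); apply pow_incr; lra.
- auto_derive; auto; rewrite S_INR; destruct m; simpl; ring.
Qed.

Lemma is_RInt_inner (m : nat) (y : R) : 0 < y < 1 ->
  is_RInt (fun x => (1 - x) * (x * y) ^ m * phi (x * y)) 0 1 (inner m y).
Proof.
intros Hy.
(* A primitive in [x]: the [1] of [1 - x] gives the quotient by [y], and [x = (x * y) / y] gives the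
   one by [y ^ 2]. *)
set (G := fun x => phi_int ((x * y) ^ (m + 1)) / y - phi_int ((x * y) ^ (m + 2)) / y ^ 2).
replace (inner m y) with (G 1 - G 0).
- apply (is_RInt_derive G); intros x Hx; rewrite Rmin_left, Rmax_right in Hx by lra;
    assert (xy : 0 <= x * y < 1) by nra.
  + assert (D : forall k, is_derive (fun x => phi_int ((x * y) ^ (k + 1))) x
                                    (y * (phi (x * y) * (x * y) ^ k))).
    { intros k; apply (is_derive_comp (fun u => phi_int (u ^ (k + 1))) (fun x => x * y)).
      - now apply is_derive_phi_int_pow.
      - auto_derive; auto; ring. }
    assert (D2 := D (S m)); replace (S m + 1)%nat with (m + 2)%nat in D2 by lia.
    replace ((1 - x) * (x * y) ^ m * phi (x * y))
      with (/ y * (y * (phi (x * y) * (x * y) ^ m)) - / y ^ 2 * (y * (phi (x * y) * (x * y) ^ S m)))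
      by (simpl; field; lra).
    apply (is_derive_ext (fun x => / y * phi_int ((x * y) ^ (m + 1))
                                   - / y ^ 2 * phi_int ((x * y) ^ (m + 2)))).
    { intros t; unfold G; match goal with |- ?l = ?r => change (@eq R l r) end; field; lra. }
    apply (is_derive_minus (K := R_AbsRing) (V := R_NormedModule));
      apply is_derive_scal; [apply D | exact D2].
  + apply (continuous_mult (fun x => (1 - x) * (x * y) ^ m) (fun x => phi (x * y))).
    * apply (ex_derive_continuous (fun x => (1 - x) * (x * y) ^ m) x); auto_derive; auto.
    * apply (continuous_comp (fun x => x * y) phi); [| apply continuous_phi; lra].
      apply (ex_derive_continuous (fun x => x * y) x); auto_derive; auto.
- unfold G, inner; rewrite Rmult_1_l, Rmult_0_l, !pow_i, phi_int_0 by lia; field; lra.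
Qed.

(** Obtained by parts. As [phi y * ln y = -1], a primitive of [phi_int (y ^ (m + 1)) / y] is
    [phi_int (y ^ (m + 1)) * ln y + y ^ (m + 1) / (m + 1)]; one of [phi_int (y ^ (m + 2)) / y ^ 2]
    is [phi_int (y ^ (m + 1)) - phi_int (y ^ (m + 2)) / y]. *)
Definition inner_prim (m : nat) (y : R) : R :=
  phi_int (y ^ (m + 1)) * ln y + phi_int (y ^ (m + 2)) / y - phi_int (y ^ (m + 1))
  + y ^ (m + 1) / (INR m + 1).

Lemma is_derive_inner_prim (m : nat) (y : R) : 0 < y < 1 ->
  is_derive (inner_prim m) y (inner m y).
Proof.
intros Hy; assert (m0 := pos_INR m).
assert (D1 := is_derive_phi_int_pow m y ltac:(lra)).
assert (D2 := is_derive_phi_int_pow (S m) y ltac:(lra)).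
replace (S m + 1)%nat with (m + 2)%nat in D2 by lia.
set (f1 := fun u => phi_int (u ^ (m + 1))) in *; set (f2 := fun u => phi_int (u ^ (m + 2))) in *.
assert (L := opp_ln_ge y ltac:(lra)).
apply (is_derive_ext (fun y => f1 y * ln y + f2 y / y - f1 y + y ^ (m + 1) / (INR m + 1))).
{ reflexivity. }
auto_derive.
- repeat split; try lra; [eexists; exact D1 | eexists; exact D2 | eexists; exact D1].
- assert (E1 : Derive (fun x => f1 x) y = phi y * y ^ m) by exact (is_derive_unique _ _ _ D1).
  assert (E2 : Derive (fun x => f2 x) y = phi y * y ^ S m) by exact (is_derive_unique _ _ _ D2).
  rewrite E1, E2.
  replace (Init.Nat.pred (m + 1)) with m by lia.
  rewrite plus_INR; simpl (INR 1).
  unfold inner; fold (f1 y) (f2 y); unfold phi; simpl; field; lra.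
Qed.

(** * One-sided limits and the fundamental theorem on an open interval *)

Lemma filterlim_squeeze_continuous (G : (R -> Prop) -> Prop) (FG : Filter G) (c : R)
  (f lo up : R -> R) (l : R) :
  filter_le G (locally c) -> G (fun y => 0 < y < 1) ->
  continuous lo c -> continuous up c -> lo c = l -> up c = l ->
  (forall y, 0 < y < 1 -> lo y <= f y <= up y) -> filterlim f G (locally l).
Proof.
intros Gc G01 Clo Cup El Eu B.
apply (filterlim_le_le lo f up l).
- exact (filter_imp _ _ B G01).
- rewrite <- El; exact (filterlim_filter_le_1 _ Gc Clo).
- rewrite <- Eu; exact (filterlim_filter_le_1 _ Gc Cup).
Qed.

Lemma at_right_0_in_01 : at_right 0 (fun y => 0 < y < 1).
Proof.
exists (mkposreal 1 Rlt_0_1); intros v Hv v0.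
  apply ball_R in Hv; simpl in Hv; lra.
Qed.

Lemma at_left_1_in_01 : at_left 1 (fun y => 0 < y < 1).
Proof.
exists (mkposreal 1 Rlt_0_1); intros v Hv v1.
  apply ball_R in Hv; simpl in Hv; lra.
Qed.

(** [F] and [H] extend to continuous functions [f] and [h] on the line. On [(a, b)] the difference
    of [RInt f a] and [h] has derivative [0], so the mean value theorem gives the integral of [f],
    which agrees with [F] inside the interval. *)
Lemma is_RInt_open_derive (F H : R -> R) (a b la lb ha hb : R) : a < b ->
  (forall y, a < y < b -> continuous F y) -> (forall y, a < y < b -> is_derive H y (F y)) ->
  filterlim F (at_right a) (locally la) -> filterlim F (at_left b) (locally lb) ->
  filterlim H (at_right a) (locally ha) -> filterlim H (at_left b) (locally hb) ->
  is_RInt F a b (hb - ha).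
Proof.
intros ab cF dH Fa Fb Ha Hb.
destruct (C0_extension_lt F la lb a b ab cF Fa Fb) as (f & cf & Ef & _).
destruct (C0_extension_lt H ha hb a b ab
            (fun y Hy => ex_derive_continuous H y (ex_intro _ _ (dH y Hy))) Ha Hb)
  as (h & ch & Eh & Eha & Ehb).
assert (I : forall y, is_RInt f a y (RInt f a y)).
{ intros y; apply is_RInt_RInt, (ex_RInt_continuous (V := R_CompleteNormedModule)); intros; apply cf. }
assert (D : forall y, is_derive (RInt f a) y (f y)).
{ intros y; apply (is_derive_RInt f (RInt f a) a); [apply filter_forall, I | apply cf]. }
apply (is_RInt_ext f); [rewrite Rmin_left, Rmax_right by lra; exact Ef |].
replace (hb - ha) with (RInt f a b); [apply I |].
destruct (MVT_gen (fun y => RInt f a y - h y) a b (fun _ => 0)) as (c & _ & E).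
- rewrite Rmin_left, Rmax_right by lra; intros y Hy.
  replace 0 with (f y - F y) by (rewrite Ef by auto; ring).
  apply (is_derive_minus (K := R_AbsRing) (V := R_NormedModule)); [apply D |].
  apply (is_derive_ext_loc H); [| now apply dH].
  exists (mkposreal (Rmin (y - a) (b - y)) ltac:(apply Rmin_glb_lt; lra)); intros t Ht.
  assert (M1 := Rmin_l (y - a) (b - y)); assert (M2 := Rmin_r (y - a) (b - y)).
  apply ball_R in Ht; simpl in Ht; symmetry; apply Eh; lra.
- intros y _; apply continuity_pt_filterlim.
  apply (continuous_minus (V := R_NormedModule) (RInt f a) h); [| apply ch].
  apply (ex_derive_continuous (RInt f a)); eexists; apply D.
- assert (Z : RInt f a a = 0) by apply (RInt_point (V := R_CompleteNormedModule)).
  rewrite Z, Eha, Ehb in E; lra.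
Qed.

(** The factor [sqrt (1 - y)] is not differentiable at [1], but since [sqrt] is [0] on negative
    arguments it is continuous there from both sides. *)
Lemma continuous_sqrt_comb (p r : R -> R) : ex_derive p 1 -> ex_derive r 1 ->
  continuous (fun y => p y + sqrt (1 - y) * r y) 1.
Proof.
intros dp dr; apply (continuous_plus (V := R_NormedModule)); [now apply ex_derive_continuous in dp |].
apply (continuous_mult (K := R_AbsRing)); [| now apply ex_derive_continuous in dr].
apply (continuous_comp (fun y => 1 - y) sqrt); [| apply continuous_sqrt].
apply (ex_derive_continuous (fun y => 1 - y)); auto_derive; auto.
Qed.

(** [phi] increases, so [phi_int v <= v * phi v]. The exponent [n] is left free to match the power
    of [y] by which [phi_int] is divided near [0]. *)
Lemma phi_int_pow_le_0 (y : R) (m n : nat) : 0 < y < 1 -> (n <= m)%nat ->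
  0 <= phi_int (y ^ (m + 1)) <= y ^ (n + 1) * phi y.
Proof.
intros Hy nm; replace (m + 1)%nat with (S m) by lia.
assert (P := pow_in_01 y m Hy).
split; [apply phi_int_ge0; lra |].
apply Rle_trans with (1 := phi_int_le_mul (y ^ S m) ltac:(lra)).
apply Rmult_le_compat; try lra; [apply phi_ge0; lra | | apply phi_le; lra].
replace (S m) with (n + 1 + (m - n))%nat by lia; rewrite pow_add.
rewrite <- (Rmult_1_r (y ^ (n + 1))) at 2; apply Rmult_le_compat_l; [apply pow_le; lra |].
rewrite <- (pow1 (m - n)); apply pow_incr; lra.
Qed.

Lemma phi_int_pow_le_1 (y : R) (m : nat) : 0 < y < 1 ->
  0 <= phi_int (y ^ (m + 1)) * (1 - y) <= 2 * sqrt (1 - y).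
Proof.
intros Hy; assert (P := pow_in_01 y m Hy); replace (m + 1)%nat with (S m) by lia.
assert (phi_int (y ^ S m) <= phi_int y) by (apply phi_int_le; lra).
assert (0 <= phi_int (y ^ S m)) by (apply phi_int_ge0; lra).
assert (N := phi_int_near_1 y ltac:(lra)); split; nra.
Qed.

(** Each of the two quotients lies between [0] and [phi y], which tends to [0]. *)
Lemma filterlim_inner_0 (m : nat) : filterlim (inner m) (at_right 0) (locally 0).
Proof.
assert (C := continuous_phi 0 Rlt_0_1).
assert (Z := phi_nonpos_arg 0 (Rle_refl 0)).
apply (filterlim_squeeze_continuous _ _ 0 _ (fun y => - phi y) phi); auto.
- apply filter_le_within.
- apply at_right_0_in_01.
- apply (continuous_opp (V := R_NormedModule) phi), C.
- rewrite Z; ring.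
- intros y Hy; unfold inner.
  assert (A1 := phi_int_pow_le_0 y m 0 Hy ltac:(lia)).
  assert (A2 := phi_int_pow_le_0 y (S m) 1 Hy ltac:(lia)).
  replace (S m + 1)%nat with (m + 2)%nat in A2 by lia.
  simpl (0 + 1)%nat in A1; rewrite pow_1 in A1; simpl (1 + 1)%nat in A2.
  assert (y2 : 0 < y ^ 2) by (apply pow_lt; lra).
  assert (0 <= phi_int (y ^ (m + 1)) / y <= phi y).
  { split; [apply Rmult_le_pos; [lra | apply Rlt_le, Rinv_0_lt_compat; lra] |].
    apply Rle_div_l; lra. }
  assert (0 <= phi_int (y ^ (m + 2)) / y ^ 2 <= phi y).
  { split; [apply Rmult_le_pos; [lra | apply Rlt_le, Rinv_0_lt_compat; lra] |].
    apply Rle_div_l; lra. }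
  lra.
Qed.

Lemma filterlim_inner_prim_0 (m : nat) : filterlim (inner_prim m) (at_right 0) (locally 0).
Proof.
assert (C := continuous_phi 0 Rlt_0_1).
assert (Z := phi_nonpos_arg 0 (Rle_refl 0)).
assert (Ci : forall c : R, continuous (fun y => c * y + c * phi y) 0).
{ intros c; apply (continuous_plus (V := R_NormedModule) (fun y => c * y) (fun y => c * phi y)).
  - apply (ex_derive_continuous (fun y => c * y)); auto_derive; auto.
  - apply (continuous_mult (K := R_AbsRing) (fun _ => c) phi); [apply continuous_const | exact C]. }
apply (filterlim_squeeze_continuous _ _ 0 _ (fun y => -2 * y + -2 * phi y) (fun y => 2 * y + 2 * phi y));
  auto.
- apply filter_le_within.
- apply at_right_0_in_01.
- rewrite Z; ring.
- rewrite Z; ring.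
- intros y Hy; unfold inner_prim; assert (m0 := pos_INR m).
  assert (A1 := phi_int_pow_le_0 y m 0 Hy ltac:(lia)).
  assert (A2 := phi_int_pow_le_0 y (S m) 1 Hy ltac:(lia)).
  replace (S m + 1)%nat with (m + 2)%nat in A2 by lia.
  simpl (0 + 1)%nat in A1; rewrite pow_1 in A1; simpl (1 + 1)%nat in A2.
  assert (p0 := phi_ge0 y ltac:(lra)).
  assert (L := opp_ln_ge y ltac:(lra)).
  (* [phi y] cancels the unbounded factor [ln y], which leaves a product of size at most [y]. *)
  assert (E : phi y * - ln y = 1) by (unfold phi; field; lra).
  assert (B1 : 0 <= phi_int (y ^ (m + 1)) * - ln y <= y).
  { split; [apply Rmult_le_pos; lra |].
    replace y with (y * phi y * - ln y) at 3 by (rewrite Rmult_assoc, E; ring).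
    apply Rmult_le_compat_r; lra. }
  assert (B2 : 0 <= phi_int (y ^ (m + 2)) / y <= phi y).
  { split; [apply Rmult_le_pos; [lra | apply Rlt_le, Rinv_0_lt_compat; lra] |].
    apply Rle_div_l; [lra |]; nra. }
  assert (B3 : phi_int (y ^ (m + 1)) <= phi y) by nra.
  assert (P := pow_in_01 y m Hy); replace (S m) with (m + 1)%nat in P by lia.
  assert (B4 : 0 <= y ^ (m + 1) / (INR m + 1) <= y).
  { split; [apply Rmult_le_pos; [lra | apply Rlt_le, Rinv_0_lt_compat; lra] |].
    apply Rle_div_l; nra. }
  lra.
Qed.

Lemma filterlim_inner_1 (m : nat) :
  filterlim (inner m) (at_left 1) (locally (ln ((INR m + 2) / (INR m + 1)))).
Proof.
set (X := ln ((INR m + 2) / (INR m + 1))).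
apply (filterlim_squeeze_continuous _ _ 1 _
        (fun y => y ^ (m + 2) * X / y + sqrt (1 - y) * (- 2 / y ^ 2)) (fun y => X / y)).
- apply filter_le_within.
- apply at_left_1_in_01.
- apply (continuous_sqrt_comb (fun y => y ^ (m + 2) * X / y) (fun y => - 2 / y ^ 2));
    auto_derive; lra.
- apply (ex_derive_continuous (fun y => X / y)); auto_derive; lra.
- rewrite Rminus_diag, sqrt_0, !pow1; field.
- field.
- intros y Hy; unfold inner.
  assert (D := phi_int_pow_diff y m Hy); cbv zeta in D; fold X in D.
  assert (N := phi_int_pow_le_1 y (S m) Hy).
  replace (S m + 1)%nat with (m + 2)%nat in N by lia.
  set (s := sqrt (1 - y)) in *; set (a1 := phi_int (y ^ (m + 1))) in *.
  set (a2 := phi_int (y ^ (m + 2))) in *.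
  assert (y2 : 0 < y ^ 2) by (apply pow_lt; lra).
  (* [a1] and [a2] both diverge at [1]; regrouping leaves the bounded difference [a1 - a2] and the
     product [a2 * (1 - y)], which tends to [0]. *)
  replace (a1 / y - a2 / y ^ 2) with ((y * (a1 - a2) - a2 * (1 - y)) / y ^ 2) by (field; lra).
  split.
  + replace (y ^ (m + 2) * X / y + s * (- 2 / y ^ 2))
      with ((y * (y ^ (m + 2) * X) - 2 * s) / y ^ 2) by (field; lra).
    apply Rmult_le_compat_r; [apply Rlt_le, Rinv_0_lt_compat; lra | nra].
  + replace (X / y) with ((y * X) / y ^ 2) by (field; lra).
    apply Rmult_le_compat_r; [apply Rlt_le, Rinv_0_lt_compat; lra | nra].
Qed.

Lemma filterlim_inner_prim_1 (m : nat) :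
  filterlim (inner_prim m) (at_left 1) (locally (gamma_coef m)).
Proof.
assert (m0 := pos_INR m); unfold gamma_coef.
set (X := ln ((INR m + 2) / (INR m + 1))).
set (p := fun y => y ^ (m + 1) / (INR m + 1)).
apply (filterlim_squeeze_continuous _ _ 1 _
        (fun y => (p y - X) + sqrt (1 - y) * (- 2 / y))
        (fun y => (p y - y ^ (m + 2) * X) + sqrt (1 - y) * (2 / y))).
- apply filter_le_within.
- apply at_left_1_in_01.
- apply (continuous_sqrt_comb (fun y => p y - X) (fun y => - 2 / y)); unfold p; auto_derive; lra.
- apply (continuous_sqrt_comb (fun y => p y - y ^ (m + 2) * X) (fun y => 2 / y));
    unfold p; auto_derive; lra.
- unfold p; rewrite Rminus_diag, sqrt_0, !pow1; field; lra.
- unfold p; rewrite Rminus_diag, sqrt_0, !pow1; field; lra.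
- intros y Hy; unfold inner_prim; fold (p y).
  assert (D := phi_int_pow_diff y m Hy); cbv zeta in D; fold X in D.
  assert (N1 := phi_int_pow_le_1 y m Hy).
  assert (N2 := phi_int_pow_le_1 y (S m) Hy).
  replace (S m + 1)%nat with (m + 2)%nat in N2 by lia.
  assert (L1 := opp_ln_ge y ltac:(lra)); assert (L2 := opp_ln_le y ltac:(lra)).
  set (s := sqrt (1 - y)) in *; set (a1 := phi_int (y ^ (m + 1))) in *.
  set (a2 := phi_int (y ^ (m + 2))) in *.
  assert (iy : 0 < / y) by (apply Rinv_0_lt_compat; lra).
  assert (a10 : 0 <= a1) by nra.
  assert (B1 : 0 <= a1 * - ln y <= s * (2 / y)).
  { split; [apply Rmult_le_pos; lra |].
    apply Rle_trans with (a1 * ((1 - y) / y)); [apply Rmult_le_compat_l; lra |].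
    unfold Rdiv; rewrite <- !Rmult_assoc; apply Rmult_le_compat_r; lra. }
  assert (B2 : 0 <= a2 * (1 - y) / y <= s * (2 / y)).
  { unfold Rdiv; split; [apply Rmult_le_pos; lra |].
    rewrite <- !Rmult_assoc; apply Rmult_le_compat_r; lra. }
  (* A similar regrouping; the product with [ln y] is small because [- ln y <= (1 - y) / y]. *)
  replace (a1 * ln y + a2 / y - a1 + p y) with (p y - (a1 - a2) - a1 * - ln y + a2 * (1 - y) / y)
    by (field; lra).
  replace (s * (- 2 / y)) with (- (s * (2 / y))) by (field; lra).
  lra.
Qed.

Lemma is_RInt_inner_total (m : nat) : is_RInt (inner m) 0 1 (gamma_coef m).
Proof.
replace (gamma_coef m) with (gamma_coef m - 0) by ring.
apply (is_RInt_open_derive (inner m) (inner_prim m) 0 1 0 (ln ((INR m + 2) / (INR m + 1)))).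
- lra.
- intros y Hy.
  assert (D : forall k, ex_derive (fun y => phi_int (y ^ (k + 1))) y).
  { intros k; eexists; apply is_derive_phi_int_pow; lra. }
  assert (D1 := D m); assert (D2 := D (S m)).
  replace (S m + 1)%nat with (m + 2)%nat in D2 by lia.
  apply (ex_derive_continuous (inner m)).
  apply (ex_derive_minus (K := R_AbsRing) (V := R_NormedModule));
    [apply (ex_derive_div (fun y => phi_int (y ^ (m + 1))) (fun y => y))
    |apply (ex_derive_div (fun y => phi_int (y ^ (m + 2))) (fun y => y ^ 2))];
    auto; try (auto_derive; auto); try (apply pow_nonzero); lra.
- intros y Hy; now apply is_derive_inner_prim.
- apply filterlim_inner_0.
- apply filterlim_inner_1.
- apply filterlim_inner_prim_0.
- apply filterlim_inner_prim_1.
Qed.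

(** * The double integral *)

Lemma integrand34_phi (q : nat) (x y : R) :
  integrand34 q x y = (1 - x) * phi (x * y) * / (1 + (x * y) ^ q).
Proof.
unfold integrand34, phi, Rdiv; rewrite <- Rpow_mult_distr, Rinv_mult; ring.
Qed.

Lemma one_plus_pow_ge1 (u : R) (q : nat) : 0 <= u -> 1 <= 1 + u ^ q.
Proof. intros u0; assert (P := pow_le u q u0); lra. Qed.

Lemma ex_RInt_integrand34 (q : nat) (y : R) : 0 < y < 1 ->
  ex_RInt (fun x => integrand34 q x y) 0 1.
Proof.
intros Hy.
apply (ex_RInt_ext (fun x => (1 - x) * phi (x * y) * / (1 + (x * y) ^ q))).
{ intros; symmetry; apply integrand34_phi. }
apply (@ex_RInt_continuous R_CompleteNormedModule); intros x Hx.
rewrite Rmin_left, Rmax_right in Hx by lra; assert (xy : 0 <= x * y < 1) by nra.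
assert (P := one_plus_pow_ge1 (x * y) q (proj1 xy)).
apply (continuous_mult (K := R_AbsRing) (fun x => (1 - x) * phi (x * y)) (fun x => / (1 + (x * y) ^ q))).
- apply (continuous_mult (K := R_AbsRing) (fun x => 1 - x) (fun x => phi (x * y))).
  + apply (ex_derive_continuous (fun x => 1 - x)); auto_derive; auto.
  + apply (continuous_comp (fun x => x * y) phi); [| apply continuous_phi; lra].
    apply (ex_derive_continuous (fun x => x * y) x); auto_derive; auto.
- apply (ex_derive_continuous (fun x => / (1 + (x * y) ^ q))); auto_derive; lra.
Qed.

Lemma geometric_psum (v : R) (N : nat) : psum (fun j => v ^ j) N * (1 - v) = 1 - v ^ N.
Proof. induction N as [| N IH]; simpl; [ring | rewrite Rmult_plus_distr_r, IH; ring]. Qed.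

Lemma is_RInt_psum (f : nat -> R -> R) (l : nat -> R) (a b : R) (N : nat) :
  (forall j, is_RInt (f j) a b (l j)) ->
  is_RInt (fun x => psum (fun j => f j x) N) a b (psum l N).
Proof.
intros H; induction N as [| N IH]; simpl.
- assert (Z : is_RInt (fun _ => 0) a b ((b - a) * 0)) by exact (is_RInt_const a b 0).
  rewrite Rmult_0_r in Z; exact Z.
- apply (is_RInt_plus (V := R_NormedModule)); [exact IH | apply H].
Qed.

(** With [u = x * y], truncating the geometric series leaves an error of size [(1 - x) * phi u * u ^
    (q * N) / (1 + u ^ q)]. From [u <= x] follow [(1 - x) * phi u <= (1 - u) / (1 - u) = 1] and
    [u ^ q <= x], so the bound is free of [y]. *)
Lemma integrand34_partial_sum (q N : nat) (x y : R) : (0 < q)%nat -> 0 <= x <= 1 -> 0 < y < 1 ->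
  Rabs (integrand34 q x y
        - psum (fun j => (-1) ^ j * ((1 - x) * (x * y) ^ (q * j) * phi (x * y))) N) <= x ^ N.
Proof.
intros q0 Hx Hy; rewrite integrand34_phi; set (u := x * y).
assert (Hu : 0 <= u < 1) by (unfold u; nra); assert (ux : u <= x) by (unfold u; nra).
assert (P := one_plus_pow_ge1 u q (proj1 Hu)).
set (c := (1 - x) * phi u).
assert (Hc : 0 <= c <= 1).
{ assert (p0 := phi_ge0 u ltac:(lra)); assert (p1 := phi_le_inv u ltac:(lra)); unfold c.
  split; [apply Rmult_le_pos; lra |].
  apply Rle_trans with ((1 - u) * / (1 - u)); [apply Rmult_le_compat; lra | rewrite Rinv_r; lra]. }
rewrite (psum_ext _ (fun j => c * (- u ^ q) ^ j)).
- rewrite (psum_scal c (fun j => (- u ^ q) ^ j)).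
  assert (G := geometric_psum (- u ^ q) N).
  replace (c * / (1 + u ^ q) - c * psum (fun j => (- u ^ q) ^ j) N)
    with (c * / (1 + u ^ q) * (- u ^ q) ^ N).
  + rewrite Rabs_mult, <- RPow_abs, Rabs_Ropp, Rabs_right, Rabs_right.
    * assert (i0 : 0 < / (1 + u ^ q)) by (apply Rinv_0_lt_compat; lra).
      assert (i1 : / (1 + u ^ q) <= 1) by (rewrite <- Rinv_1; apply Rinv_le_contravar; lra).
      assert (K : 0 <= (u ^ q) ^ N <= x ^ N).
      { split; [apply pow_le, pow_le; lra |].
        apply pow_incr; split; [apply pow_le; lra |].
        apply Rle_trans with (2 := ux); destruct q as [| q]; [lia |].
        simpl; rewrite <- (Rmult_1_r u) at 3; apply Rmult_le_compat_l; [lra |].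
        rewrite <- (pow1 q); apply pow_incr; lra. }
      assert (0 <= c * / (1 + u ^ q) <= 1) by (split; [apply Rmult_le_pos | ]; nra).
      nra.
    * apply Rle_ge, pow_le; lra.
    * apply Rle_ge, Rmult_le_pos; [lra | apply Rlt_le, Rinv_0_lt_compat; lra].
  + apply Rmult_eq_reg_r with (1 + u ^ q); [| lra].
    replace (1 - - u ^ q) with (1 + u ^ q) in G by ring.
    replace ((c * / (1 + u ^ q) - c * psum (fun j => (- u ^ q) ^ j) N) * (1 + u ^ q))
      with (c - c * (psum (fun j => (- u ^ q) ^ j) N * (1 + u ^ q))) by (field; lra).
    rewrite G; field; lra.
- intros j; unfold c; rewrite pow_mult.
  replace (- u ^ q) with (-1 * u ^ q) by ring; rewrite Rpow_mult_distr; ring.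
Qed.

(** Integrating the pointwise bound [x ^ N] gives an error uniform in [y], which allows the exchange
    of the limit with the outer integral. *)
Lemma RInt_integrand34_partial_sum (q N : nat) (y : R) : (0 < q)%nat -> 0 < y < 1 ->
  Rabs (RInt (fun x => integrand34 q x y) 0 1
        - psum (fun j => (-1) ^ j * inner (q * j) y) N) <= / (INR N + 1).
Proof.
intros q0 Hy.
assert (I1 := is_RInt_RInt _ _ _ (ex_RInt_integrand34 q y Hy)).
assert (I2 : is_RInt (fun x => psum (fun j => (-1) ^ j * ((1 - x) * (x * y) ^ (q * j) * phi (x * y))) N)
               0 1 (psum (fun j => (-1) ^ j * inner (q * j) y) N)).
{ apply is_RInt_psum; intros j.
  apply (is_RInt_scal (V := R_NormedModule)), is_RInt_inner, Hy. }
assert (I3 : is_RInt (fun x => x ^ N) 0 1 (/ (INR N + 1))).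
{ assert (n0 := pos_INR N).
  replace (/ (INR N + 1)) with (1 ^ S N / INR (S N) - 0 ^ S N / INR (S N)).
  - apply (is_RInt_derive (fun x => x ^ S N / INR (S N))); intros x _.
    + rewrite S_INR; auto_derive; [auto |]; destruct N; simpl in *; field; lra.
    + apply (ex_derive_continuous (fun x => x ^ N)); auto_derive; auto.
  - rewrite pow1, pow_i, S_INR by lia; field; lra. }
apply (norm_RInt_le (V := R_NormedModule)) with (4 := I3)
  (3 := is_RInt_minus (V := R_NormedModule) _ _ _ _ _ _ I1 I2); [lra |].
intros x Hx; now apply integrand34_partial_sum.
Qed.

Lemma is_RInt_integrand34 (q : nat) (l : R) : (0 < q)%nat ->
  is_lim_seq (fun n => psum (alt_gamma_coef q) (2 * n)) l ->
  is_RInt (fun y => RInt (fun x => integrand34 q x y) 0 1) 0 1 l.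
Proof.
intros q0 Hl.
(* Only [0 < y < 1] is controlled, whereas [filterlim_RInt] asks for uniform convergence on R. *)
set (cut := fun (h : R -> R) y => if Rlt_dec 0 y then if Rlt_dec y 1 then h y else 0 else 0).
assert (cutE : forall h y, 0 < y < 1 -> cut h y = h y).
{ intros h y Hy; unfold cut; destruct (Rlt_dec 0 y); [destruct (Rlt_dec y 1) |]; auto; exfalso; lra. }
set (s := fun N y => psum (fun j => (-1) ^ j * inner (q * j) y) N).
set (g := fun y => RInt (fun x => integrand34 q x y) 0 1).
(* Uniform convergence yields the integral of the limit as the limit [L] of the integrals, which are
   the partial sums of [alt_gamma_coef q]. *)
destruct (filterlim_RInt (V := R_CompleteNormedModule) (fun N => cut (s N)) 0 1 eventually
            _ (cut g) (psum (alt_gamma_coef q))) as (L & HL & HI).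
- intros N; apply (is_RInt_ext (s N)).
  { rewrite Rmin_left, Rmax_right by lra; intros; symmetry; auto. }
  apply is_RInt_psum; intros j.
  apply (is_RInt_scal (V := R_NormedModule)), is_RInt_inner_total.
- intros P [eps HP].
  destruct (INR_unbounded (/ eps)) as [M HM].
  exists M; intros N HN; apply HP; intros y.
  assert (e0 := cond_pos eps); assert (ie := Rinv_0_lt_compat _ e0).
  change (Rabs (cut (s N) y - cut g y) < eps).
  unfold cut; destruct (Rlt_dec 0 y) as [y0 |]; [destruct (Rlt_dec y 1) as [y1 |] |];
    try (rewrite Rminus_diag, Rabs_R0; exact e0).
  rewrite Rabs_minus_sym.
  apply Rle_lt_trans with (1 := RInt_integrand34_partial_sum q N y q0 (conj y0 y1)).
  rewrite <- (Rinv_inv eps); apply le_INR in HN.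
  apply Rinv_lt_contravar; [apply Rmult_lt_0_compat |]; lra.
- apply (is_RInt_ext (cut g)); [rewrite Rmin_left, Rmax_right by lra; auto |].
  replace l with L; [exact HI |].
  (* [L] is the limit of all partial sums, [l] that of the even ones; the subsequence identifies
     them. *)
  assert (HL' : is_lim_seq (fun n => psum (alt_gamma_coef q) (2 * n)) L).
  { apply (is_lim_seq_subseq (psum (alt_gamma_coef q)) L (fun n => 2 * n)%nat); [| exact HL].
    apply filterlim_eventually_ge; intros; lia. }
  apply is_lim_seq_unique in Hl; apply is_lim_seq_unique in HL'.
  rewrite Hl in HL'; now injection HL'.
Qed.

Theorem theorem34 (q : nat) (hq : (0 < q)%nat) :
  let I := 1 / (2 * INR q) *
             (digamma ((INR q + 1) / (2 * INR q)) - digamma (1 / (2 * INR q)))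
           - ln ((Gamma (1 / (2 * INR q)) * Gamma ((INR q + 2) / (2 * INR q)))
                 / (Gamma (1 / INR q) * Gamma ((INR q + 1) / (2 * INR q)))) in
  Cmult (RtoC (/ INR q))
        (sum_n (fun k => gamma_series (Cpow (omega q) (2 * k + 1))) (q - 1))
    = RtoC I
  /\ (forall y, 0 < y < 1 -> ex_RInt (fun x => integrand34 q x y) 0 1)
  /\ is_RInt (fun y => RInt (fun x => integrand34 q x y) 0 1) 0 1 I.
Proof.
intros I; assert (HI := alt_gamma_coef_lim q hq); fold I in HI; split; [| split].
- now apply mean_gamma_series.
- intros y Hy; now apply ex_RInt_integrand34.
- now apply is_RInt_integrand34.
Qed.
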